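(* Let $Q$ be an acyclic valued quiver with vertex set $\{1,\ldots,n\}$. There exists an algebra homomorphism $\varphi:\mathbf{U}^+_v(\mathfrak{g})\rightarrow\mathcal{A}_q(Q)$ defined on generators by $$\varphi(E_i)=v_i^{\frac{1}{2}}(q_i-1)^{-1}y_i,\qquad 1\leq i\leq n.$$
   Context: Let $k=\mathbb{F}_q$ be a finite field with $q$ elements and $v=\sqrt{q}$. A valued quiver is a finite quiver with a positive integer $d_i$ (valuation) attached to each vertex $i$; a finite-dimensional $k$-representation assigns to each vertex $i$ a finite-dimensional $\mathbb{F}_{q^{d_i}}$-vector space and to each arrow $i\to j$ an $\mathbb{F}_{q^{\gcd(d_i,d_j)}}$-linear map (fields inside a fixed algebraic closure of $k$). Write $q_i=q^{d_i}$, $v_i=v^{d_i}$. Let $\mathcal{A}$ be the category of finite-dimensional $k$-representations of the acyclic valued quiver $Q$, $S_i$ the simple representation at $i$, $\mathcal{D}_i=\operatorname{End}_{\mathcal{A}}(S_i)$, $d_i=\dim_k\mathcal{D}_i$, $D=\operatorname{diag}(d_1,\ldots,d_n)$. For $1\le i,j\le n$ set $r_{ij}=\dim_{\mathcal{D}_i}\operatorname{Ext}^1_{\mathcal{A}}(S_j,S_i)$, $r'_{ij}=\dim_{\mathcal{D}_i^{op}}\operatorname{Ext}^1_{\mathcal{A}}(S_i,S_j)$, $R=(r_{ij})$, $R'=(r'_{ij})$, and $c_{ii}=2$, $c_{ij}=-r_{ij}-r'_{ij}$ for $i\neq j$. Then $C=(c_{ij})$ is a symmetrizable generalized Cartan matrix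 with symmetrizer $D$; $\mathfrak g$ is the corresponding Kac--Moody Lie algebra. The Euler form $\langle M,N\rangle=\dim_k\operatorname{Hom}_{\mathcal{A}}(M,N)-\dim_k\operatorname{Ext}^1_{\mathcal{A}}(M,N)$ has matrix $E=(I_n-R^{\mathrm{tr}})D=D(I_n-R')$, i.e. $\langle\alpha,\beta\rangle=\alpha^{\mathrm{tr}}E\beta$ on $\mathbb{Z}^n$; $I_n-R=D^{-1}E^{\mathrm{tr}}$ is invertible over $\mathbb{Z}$. Quantum group: for a positive integer $a$, $[a]=\frac{\mathbf v^a-\mathbf v^{-a}}{\mathbf v-\mathbf v^{-1}}$, $[m]^!=\prod_{i=1}^m[i]$, $\begin{bmatrix}m\\d\end{bmatrix}=\frac{[m][m-1]\cdots[m-d+1]}{[d]^!}$ (equal to $1$ for $d=0$), with subscript $c$ denoting evaluation at $\mathbf v=c$. $\mathbf{U}_v(\mathfrak g)$ is the $\mathbb{Q}(v^{1/2})$-algebra generated by $E_i,F_i,K_i^{\pm1}$ ($1\le i\le n$) with relations $K_iK_i^{-1}=K_i^{-1}K_i=1$, $K_iK_j=K_jK_i$, $K_iE_j=v_i^{c_{ij}}E_jK_i$, $K_iF_j=v_i^{-c_{ij}}F_jK_i$, $E_iF_i-F_iE_i=\frac{K_i-K_i^{-1}}{v_i-v_i^{-1}}$, $E_iF_j=F_jE_i$ for $i\ne j$, and for $i\neq j$: $\sum_{t=0}^{1-c_{ij}}(-1)^t\begin{bmatrix}1-c_{ij}\\t\end{bmatrix}_{v_i}Z_i^{1-c_{ij}-t}Z_jZ_i^t=0$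 for $Z=E$ and $Z=F$. $\mathbf{U}_v^+(\mathfrak g)$ is the subalgebra generated by all $E_i$. Compatible pair: $\widetilde B=(b_{ij})=\begin{pmatrix}R'-R\\ I_n\end{pmatrix}$ ($2n\times n$), $\Gamma=\begin{pmatrix}E^{\mathrm{tr}}-E&-E^{\mathrm{tr}}-E\\ E^{\mathrm{tr}}+E&E^{\mathrm{tr}}-E\end{pmatrix}$, $\Theta=\begin{pmatrix}-D^{-1}E&-D^{-1}E^{\mathrm{tr}}\\ I_n&0\end{pmatrix}$ (invertible over $\mathbb Z$), $\Lambda_2=\frac12(\Theta^{-1})^{\mathrm{tr}}\Gamma\Theta^{-1}$, so that $\widetilde B^{\mathrm{tr}}\Lambda_2=(D,0)$. Quantum torus: for a skew-symmetric $m\times m$ matrix $\Lambda$ with $2\Lambda$ integral, $\mathcal{T}_{q,\Lambda}$ is the $\mathbb{Q}(q^{1/4})$-algebra with basis $\{X^{\mathbf e}:\mathbf e\in\mathbb{Z}^m\}$ and multiplication $X^{\mathbf e}X^{\mathbf f}=q^{\frac12\Lambda(\mathbf e,\mathbf f)}X^{\mathbf e+\mathbf f}$, $\Lambda(\mathbf e,\mathbf f)=\mathbf e^{\mathrm{tr}}\Lambda\mathbf f$; $\mathcal{F}_{q,\Lambda}$ is its skew-field of fractions. Quantum cluster algebra $\mathcal{A}_q(Q)$: here $m=2n$, and the initial quantum seed is $(\Lambda_2,\widetilde B,\{x_1,\dots,x_{2n}\})$ with $x_i=X^{\mathbf e_i}$, $\mathbf e_i$ standard basis vectors. For a quantum seed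 $(\Lambda,\widetilde B=(b_{ij}),\{x_i\})$ write $X^{\mathbf c}=q^{-\frac12\sum_{i<j}c_ic_j\Lambda_{ij}}x_1^{c_1}\cdots x_m^{c_m}$ and $[a]_+=\max\{0,a\}$. Its mutation in direction $k\in\{1,\dots,n\}$ is $(\Lambda',\widetilde B',\{x'_i\})$ with $\Lambda'=H^{\mathrm{tr}}\Lambda H$, where $h_{ij}=\delta_{ij}$ for $j\ne k$, $h_{kk}=-1$, $h_{ik}=[-b_{ik}]_+$ for $i\ne k$; $b'_{ij}=-b_{ij}$ if $i=k$ or $j=k$, else $b'_{ij}=b_{ij}+\frac12(|b_{ik}|b_{kj}+b_{ik}|b_{kj}|)$; $x'_i=x_i$ for $i\ne k$ and $x'_k=X^{\sum_i[b_{ik}]_+\mathbf e_i-\mathbf e_k}+X^{\sum_i[-b_{ik}]_+\mathbf e_i-\mathbf e_k}$. Quantum cluster variables are the elements $x'_i$, $1\le i\le n$, of all seeds obtained from the initial one by finite sequences of mutations. $\mathcal{A}_q(Q)$ is the subalgebra of $\mathcal{F}_{q,\Lambda_2}$ generated over $\mathbb{Q}(q^{1/4})[x_{n+1}^{\pm1},\dots,x_{2n}^{\pm1}]$ (Laurent polynomials in the frozen variables) by all quantum cluster variables. For $1\le i\le n$, $y_i$ is the quantum cluster variable obtained from the initial seed by one mutation in direction $i$: $y_i=X^{\sum_{k=1}^{2n}[b_{ki}]_+\mathbf e_k-\mathbf e_i}+X^{\sum_{k=1}^{2n}[-b_{ki}]_+\mathbf e_k-\mathbf e_i}$. *)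

(* Defs.v *)
From HB Require Import structures.
From mathcomp Require Import all_boot all_order all_algebra all_field.
From mathcomp Require Import boolp.

Set Implicit Arguments.
Unset Strict Implicit.
Unset Printing Implicit Defensive.

Import Order.TTheory GRing.Theory Num.Theory.
Local Open Scope ring_scope.

Section FiniteFields.
Variable k : finFieldType.

Definition kbar : countClosedFieldType :=
  projT1 (countable_algebraic_closure k).

Definition kbar_inj : {rmorphism k -> kbar} :=
  projT1 (projT2 (countable_algebraic_closure k)).

Lemma kbar_alg : integralRange kbar_inj.
Proof. exact: projT2 (projT2 (countable_algebraic_closure k)). Qed.

(* F_(q ^ m), as the set of roots of X ^ (q ^ m) - X in the closure. *)
Definition Fq_pred (m : nat) : {pred kbar} :=
  fun x => x ^+ (#|k| ^ m)%N == x.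

Lemma pnat_card (m : nat) : [pchar kbar].-nat (#|k| ^ m)%N.
Proof.
have [p pr_p chp] := finPcharP k.
have chK : p \in [pchar kbar] by rewrite (fmorph_pchar kbar_inj).
rewrite (eq_pnat _ (pcharf_eq chK)) pnatX.
by rewrite (card_pprimeChar chp) pnatX pnat_id.
Qed.

Lemma Fq_divring (m : nat) : divring_closed (Fq_pred m).
Proof.
have chq := pnat_card m.
split=> [|x y|x y]; rewrite !unfold_in; first by rewrite expr1n.
- by move=> /eqP xE /eqP yE; rewrite exprDn_pchar // exprNn_pchar // xE yE.
- by move=> /eqP xE /eqP yE; rewrite expr_div_n xE yE.
Qed.

HB.instance Definition _ m :=
  GRing.isDivringClosed.Build kbar (Fq_pred m) (Fq_divring m).

Record Fq (m : nat) := MkFq { Fqval : kbar; _ : Fqval \in Fq_pred m }.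

HB.instance Definition _ m := [isSub for @Fqval m].
HB.instance Definition _ m := [Choice of Fq m by <:].
HB.instance Definition _ m := [SubChoice_isSubIntegralDomain of Fq m by <:].
HB.instance Definition _ m := [SubIntegralDomain_isSubField of Fq m by <:].

Lemma Fq_incl_subproof (m n : nat) (x : Fq m) :
  (m %| n)%N -> val x \in Fq_pred n.
Proof.
case: x => x /= + /dvdnP[e ->]; rewrite !unfold_in => /eqP xE.
elim: e => [|e IHe]; first by rewrite mul0n expr1.
by rewrite mulSn expnD exprM xE.
Qed.

Definition Fq_incl (m n : nat) (h : (m %| n)%N) (x : Fq m) : Fq n :=
  MkFq (Fq_incl_subproof x h).

End FiniteFields.

Section BaseField.
Variable q : nat.

(* The field Q(q ^ (1/4)) = Q(v ^ (1/2)), where v ^ 2 = q, generated by the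
   positive real fourth root of q. *)
Definition Qroot : fieldExtType rat :=
  projT1 (num_field_exists [:: 4.-root (q%:R : algC)]).

Definition Qroot_inj : {rmorphism Qroot -> algC} :=
  projT1 (projT2 (num_field_exists [:: 4.-root (q%:R : algC)])).

(* q ^ (1/4) = v ^ (1/2) *)
Definition qroot : Qroot :=
  head 0 (s2val (projT2 (projT2 (num_field_exists [:: 4.-root (q%:R : algC)])))).

Lemma qrootE : Qroot_inj qroot = 4.-root q%:R.
Proof.
rewrite /qroot /Qroot_inj.
by case: (s2val _) (s2valP (projT2 (projT2
  (num_field_exists [:: 4.-root (q%:R : algC)])))) => [|x []] //= [].
Qed.

Lemma Qroot_gen : <<1; qroot>>%VS = fullv.
Proof.
have := s2valP (projT2 (projT2 (num_field_exists [:: 4.-root (q%:R : algC)]))).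
have := s2valP' (projT2 (projT2 (num_field_exists [:: 4.-root (q%:R : algC)]))).
by rewrite /qroot; case: (s2val _) => [|x []] //=; rewrite adjoin_seq1.
Qed.

(* q ^ s, for s in (1/4)Z *)
Definition qpow (s : rat) : Qroot := qroot ^ numq (4%:R * s).

End BaseField.

Section Quiver.
Variable n : nat.

Record valued_quiver := ValuedQuiver {
  arrow : finType;
  src : arrow -> 'I_n;
  tgt : arrow -> 'I_n;
  valuation :> 'I_n -> nat;
  valuation_gt0 : forall i, (0 < valuation i)%N
}.

Definition adj (Q : valued_quiver) : rel 'I_n :=
  fun i j => [exists a : arrow Q, (src a == i) && (tgt a == j)].

Definition acyclic (Q : valued_quiver) : Prop :=
  forall (i : 'I_n) (p : seq 'I_n),
    p != [::] -> path (adj Q) i p -> last i p != i.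

End Quiver.

Section Representations.
Variables (k : finFieldType) (n : nat) (Q : valued_quiver n).

Let gcd_arrow (a : arrow Q) : nat := gcdn (Q (src a)) (Q (tgt a)).

Record rep := Rep {
  rep_sp :> forall x : 'I_n, vectType (Fq k (Q x));
  rep_map : forall a : arrow Q, {additive rep_sp (src a) -> rep_sp (tgt a)};
  rep_mapZ : forall a (c : Fq k (gcd_arrow a)) w,
    rep_map a (Fq_incl (dvdn_gcdl _ _) c *: w)
    = Fq_incl (dvdn_gcdr _ _) c *: rep_map a w
}.

Record rep_hom (M N : rep) := RepHom {
  hom_map :> forall x, {linear M x -> N x};
  hom_mapP : forall a w, hom_map _ (rep_map M a w) = rep_map N a (hom_map _ w)
}.

Program Definition rep_id (M : rep) : rep_hom M M :=
  @RepHom M M (fun x => idfun) _.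

Program Definition simple_rep (i : 'I_n) : rep :=
  @Rep (fun x => 'rV[Fq k (Q x)]_(x == i)) (fun a => \0) _.
Next Obligation. by rewrite scaler0. Qed.

(* A short exact sequence 0 -> N -> E -> M -> 0. *)
Record extension (M N : rep) := Extension {
  ext_mid : rep;
  ext_inj : rep_hom N ext_mid;
  ext_sur : rep_hom ext_mid M;
  ext_injP : forall x, injective (ext_inj x);
  ext_surP : forall x w, exists e, ext_sur x e = w;
  ext_exact : forall x e, ext_sur x e = 0 <-> exists w, ext_inj x w = e
}.

(* In Ext^1(M, N), with Baer sum and the actions of End(N) by pushout and of
   End(M) by pullback, eta is the class of the sum of the b_l . xi_l . a_l.
   Pulling back the direct sum of the xi_l along (a_l) : M -> M^r gives
     0 -> N^r -> P -> M -> 0,  P = {(m, e) | xi_l(e_l) = a_l(m) for all l},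
   and eta is its pushout along (b_l) : N^r -> N if and only if there is a
   morphism Phi : P -> E_eta inducing (b_l) on N^r and the identity on M.
   The values of Phi outside P are irrelevant. *)
Definition baer_comb (M N : rep) (r : nat) (b : 'I_r -> rep_hom N N)
    (xi : 'I_r -> extension M N) (a : 'I_r -> rep_hom M M)
    (eta : extension M N) : Prop :=
  let P x (m : M x) (e : forall l, ext_mid (xi l) x) :=
    forall l, ext_sur (xi l) x (e l) = a l x m in
  exists Phi : forall x, M x -> (forall l, ext_mid (xi l) x) -> ext_mid eta x,
  [/\ forall x c m e m' e', P x m e -> P x m' e' ->
        Phi x (c *: m + m') (fun l => c *: e l + e' l)
        = c *: Phi x m e + Phi x m' e',
      forall (t : arrow Q) m e, P (src t) m e ->
        Phi (tgt t) (rep_map M t m) (fun l => rep_map (ext_mid (xi l)) t (e l))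
        = rep_map (ext_mid eta) t (Phi (src t) m e),
      forall x m e, P x m e -> ext_sur eta x (Phi x m e) = m
    & forall x (w : 'I_r -> N x),
        Phi x 0 (fun l => ext_inj (xi l) x (w l))
        = ext_inj eta x (\sum_l b l x (w l))].

(* Ext^1(M, N) is free of rank r as a left End(N)-module, resp. as a right
   End(M)-module: it has a basis xi of size r. *)
Definition ext_ldim (M N : rep) (r : nat) : Prop :=
  exists xi : 'I_r -> extension M N, forall eta,
    (exists b, baer_comb b xi (fun=> rep_id M) eta) /\
    (forall b b', baer_comb b xi (fun=> rep_id M) eta ->
       baer_comb b' xi (fun=> rep_id M) eta ->
       forall l x w, b l x w = b' l x w).

Definition ext_rdim (M N : rep) (r : nat) : Prop :=
  exists xi : 'I_r -> extension M N, forall eta,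
    (exists a, baer_comb (fun=> rep_id N) xi a eta) /\
    (forall a a', baer_comb (fun=> rep_id N) xi a eta ->
       baer_comb (fun=> rep_id N) xi a' eta ->
       forall l x w, a l x w = a' l x w).

(* r i j = dim_(D_i) Ext^1(S_j, S_i) and
   r' i j = dim_(D_i ^ op) Ext^1(S_i, S_j), where D_i = End(S_i). *)
Definition ext_dims (r r' : 'I_n -> 'I_n -> nat) : Prop :=
  forall i j, ext_ldim (simple_rep j) (simple_rep i) (r i j)
    /\ ext_rdim (simple_rep i) (simple_rep j) (r' i j).

End Representations.

Section GeneratedSubalgebra.
Variables (L : fieldType) (A : algType L) (S : A -> Prop).

Inductive gen_alg : A -> Prop :=
| gen_alg_gen x of S x : gen_alg x
| gen_alg1 : gen_alg 1
| gen_algP c x y of gen_alg x & gen_alg y : gen_alg (c *: x + y)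
| gen_algM x y of gen_alg x & gen_alg y : gen_alg (x * y).

Definition gen_alg_pred : {pred A} := fun x => `[< gen_alg x >].

Lemma gen_alg_closed : subalg_closed gen_alg_pred.
Proof.
split=> [|c x y|x y]; rewrite !unfold_in.
- exact/asboolP/gen_alg1.
- by move=> /asboolP hx /asboolP hy; apply/asboolP/gen_algP.
- by move=> /asboolP hx /asboolP hy; apply/asboolP/gen_algM.
Qed.

HB.instance Definition _ := GRing.isSubalgClosed.Build L A gen_alg_pred
  (GRing.subalg_closed_semi gen_alg_closed).

Record subalg := Subalg { subalg_val : A; _ : subalg_val \in gen_alg_pred }.

HB.instance Definition _ := [isSub for subalg_val].
HB.instance Definition _ := [Choice of subalg by <:].
HB.instance Definition _ := [SubChoice_isSubAlgebra of subalg by <:].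

Lemma subalg_gen_subproof x : S x -> x \in gen_alg_pred.
Proof. by move=> Sx; apply/asboolP/gen_alg_gen. Qed.

Definition subalg_gen x (Sx : S x) : subalg := Subalg (subalg_gen_subproof Sx).

End GeneratedSubalgebra.

Section QuantumGroup.
Variables (L : fieldType) (n : nat).
(* vs i is v_i and C is the Cartan matrix. *)
Variables (vs : 'I_n -> L) (C : 'M[int]_n).

Definition qint (c : L) (a : nat) : L := (c ^+ a - c ^- a) / (c - c^-1).

Definition qfact (c : L) (m : nat) : L := \prod_(1 <= i < m.+1) qint c i.

Definition qbinom (c : L) (m d : nat) : L :=
  (\prod_(s < d) qint c (m - s)) / qfact c d.

Definition serre (U : algType L) (Z : 'I_n -> U) (i j : 'I_n) : Prop :=
  let N := `|(1 - C i j)%R|%N in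
  \sum_(t < N.+1)
     ((-1) ^+ t * qbinom (vs i) N t) *: (Z i ^+ (N - t) * Z j * Z i ^+ t) = 0.

Record Uv_rel (U : algType L) (E F K K' : 'I_n -> U) : Prop := UvRel {
  Uv_KK' : forall i, K i * K' i = 1;
  Uv_K'K : forall i, K' i * K i = 1;
  Uv_KC : forall i j, K i * K j = K j * K i;
  Uv_KE : forall i j, K i * E j = vs i ^ C i j *: (E j * K i);
  Uv_KF : forall i j, K i * F j = vs i ^ (- C i j) *: (F j * K i);
  Uv_EF : forall i,
    E i * F i - F i * E i = (vs i - (vs i)^-1)^-1 *: (K i - K' i);
  Uv_EFC : forall i j, i != j -> E i * F j = F j * E i;
  Uv_serreE : forall i j, i != j -> serre E i j;
  Uv_serreF : forall i j, i != j -> serre F i j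
}.

(* U, with the given elements, is the L-algebra presented by the generators
   E_i, F_i, K_i, K_i ^ -1 and the relations Uv_rel. *)
Definition is_Uv (U : algType L) (E F K K' : 'I_n -> U) : Prop :=
  Uv_rel E F K K' /\
  forall (B : algType L) (e f h h' : 'I_n -> B), Uv_rel e f h h' ->
    (exists g : {lrmorphism U -> B}, forall i,
       [/\ g (E i) = e i, g (F i) = f i, g (K i) = h i & g (K' i) = h' i]) /\
    (forall g g' : {lrmorphism U -> B},
       (forall i, [/\ g (E i) = g' (E i), g (F i) = g' (F i),
                      g (K i) = g' (K i) & g (K' i) = g' (K' i)]) ->
       g =1 g').

Section Positive.
Variables (U : algType L) (E : 'I_n -> U).

Definition is_E (x : U) : Prop := exists i, x = E i.

Definition Uv_plus := subalg is_E.

Definition Uv_plusE (i : 'I_n) : Uv_plus :=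
  subalg_gen (ex_intro (fun j => E i = E j) i erefl).

End Positive.
End QuantumGroup.

Section CompatiblePair.
Variables (n : nat) (d : 'I_n -> nat) (r r' : 'I_n -> 'I_n -> nat).

Definition cartan : 'M[int]_n :=
  \matrix_(i, j) if i == j then 2 else - (r i j)%:Z - (r' i j)%:Z.

Let Rq : 'M[rat]_n := \matrix_(i, j) (r i j)%:R.

Definition Dmx : 'M[rat]_n := diag_mx (\row_i (d i)%:R).

Definition Emx : 'M[rat]_n := (1%:M - Rq^T) *m Dmx.

Definition Btilde : 'M[int]_(n + n, n) :=
  col_mx (\matrix_(i, j) ((r' i j)%:Z - (r i j)%:Z)) 1%:M.

Definition Gammamx : 'M[rat]_(n + n) :=
  block_mx (Emx^T - Emx) (- Emx^T - Emx) (Emx^T + Emx) (Emx^T - Emx).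

Definition Thetamx : 'M[rat]_(n + n) :=
  block_mx (- (invmx Dmx *m Emx)) (- (invmx Dmx *m Emx^T)) 1%:M 0.

Definition Lambda2 : 'M[rat]_(n + n) :=
  2%:R^-1 *: ((invmx Thetamx)^T *m Gammamx *m invmx Thetamx).

End CompatiblePair.

Section QuantumTorus.
Variables (q m : nat) (Lam : 'M[rat]_m).

Definition lform (e f : 'rV[int]_m) : rat :=
  (map_mx intr e *m Lam *m (map_mx intr f)^T) 0 0.

Definition torus_span (F : unitAlgType (Qroot q)) (X : 'rV[int]_m -> F)
    (z : F) : Prop :=
  exists (s : seq 'rV[int]_m) (c : 'rV[int]_m -> Qroot q),
    z = \sum_(e <- s) c e *: X e.

(* F is the skew field of fractions of the quantum torus attached to Lam, a
   subalgebra of F with basis the X e. *)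
Record is_torus_frac (F : unitAlgType (Qroot q)) (X : 'rV[int]_m -> F)
    : Prop := TorusFrac {
  torus1 : X 0 = 1;
  torusM : forall e f, X e * X f = qpow q (2%:R^-1 * lform e f) *: X (e + f);
  torus_free : forall (s : seq 'rV[int]_m) (c : 'rV[int]_m -> Qroot q),
    uniq s -> \sum_(e <- s) c e *: X e = 0 -> {in s, forall e, c e = 0};
  torus_unit : forall z : F, z != 0 -> z \is a GRing.unit;
  torus_frac : forall z : F, exists a b,
    [/\ torus_span X a, torus_span X b, b != 0 & z = a / b]
}.

End QuantumTorus.

Section QuantumCluster.
Variables (q n : nat) (F : unitAlgType (Qroot q)).

Definition posp (a : int) : int := Num.max 0 a.

Record qseed := QSeed {
  seed_Lam : 'M[rat]_(n + n);
  seed_B : 'M[int]_(n + n, n);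
  seed_x : 'I_(n + n) -> F
}.

Definition seed_mono (s : qseed) (c : 'I_(n + n) -> int) : F :=
  qpow q (- (2%:R^-1 * \sum_(i < n + n) \sum_(j < n + n | (i < j)%N)
             (c i)%:~R * (c j)%:~R * seed_Lam s i j))
  *: \prod_i seed_x s i ^ c i.

Definition mutate (k : 'I_n) (s : qseed) : qseed :=
  let k' := lshift n k in
  let B := seed_B s in
  let H : 'M[rat]_(n + n) := \matrix_(i, j)
    if j != k' then (i == j)%:R
    else if i == k' then -1 else (posp (- B i k))%:~R in
  QSeed
    (H^T *m seed_Lam s *m H)
    (\matrix_(i, j) if (i == k') || (j == k) then - B i j
       else B i j + ((`|B i k| * B k' j + B i k * `|B k' j|) %/ 2)%Z)
    (fun i => if i != k' then seed_x s i
       else seed_mono s (fun l => posp (B l k) - (l == k')%:Z)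
            + seed_mono s (fun l => posp (- B l k) - (l == k')%:Z)).

Definition mutates (ks : seq 'I_n) (s : qseed) : qseed :=
  foldl (fun s' k => mutate k s') s ks.

Definition qcluster_var (s0 : qseed) (z : F) : Prop :=
  exists (ks : seq 'I_n) (i : 'I_n), z = seed_x (mutates ks s0) (lshift n i).

Definition frozen (s0 : qseed) (z : F) : Prop :=
  exists j : 'I_n, z = seed_x s0 (rshift n j) \/ z = (seed_x s0 (rshift n j))^-1.

Definition qcluster_alg (s0 : qseed) :=
  subalg (fun z => frozen s0 z \/ qcluster_var s0 z).

Definition init_seed (d : 'I_n -> nat) (r r' : 'I_n -> 'I_n -> nat)
    (X : 'rV[int]_(n + n) -> F) : qseed :=
  QSeed (Lambda2 d r) (Btilde r r') (fun i => X (delta_mx 0 i)).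

(* The quantum cluster variable obtained from s0 by one mutation in
   direction i. *)
Definition mut_var (s0 : qseed) (i : 'I_n) : F :=
  seed_x (mutate i s0) (lshift n i).

End QuantumCluster.

(* Main.v *)
(** U^+ is presented by the quantum Serre relations.  Given elements y_i of an
    algebra A that satisfy them, let words in the vertices index A-valued
    functions f, with E_j acting by (E_j f)(w) = f(j w), K_i by weights, and F_i
    by the quantum shuffle operator that the relation between E_j and F_i
    forces.  All relations of U hold there except Serre for the E_i; these hold
    on the functions that kill the two-sided Serre ideal, and this subspace is
    stable because the Serre elements in the E_i commute with every F_k.  It
    contains the functions w |-> y_w c (with c in A), and x in U^+ sends such
    a function to w |-> y_w phi(x) c, which defines phi.

    The Serre polynomial is a product of commuting operators
    z |-> Z z - v_i^m z Z, m = c_ij, c_ij + 2, ..., -c_ij.  Each y_i is a sum of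
    two monomials, whose exponents are columns i and n + i of Theta, so that
    Lambda_2 takes on them the values Gamma / 2.  By acyclicity one of
    <S_i, S_j> and <S_j, S_i> vanishes, and then each of these operators sends
    one monomial to a multiple of a single other one, until the last gives 0.

    The symmetry d_i r_ij = d_j r'_ji comes from counting Ext^1(S_j, S_i) both
    as a left and as a right vector space. *)

Require Import Defs.
From HB Require Import structures.
From mathcomp Require Import all_boot all_order all_algebra all_field.
From mathcomp Require Import boolp functions.
From mathcomp Require Import zify ring.

Set Implicit Arguments.
Unset Strict Implicit.
Unset Printing Implicit Defensive.

Import Order.TTheory GRing.Theory Num.Theory.
Local Open Scope ring_scope.

(** * Quantum binomials and iterated q-commutators *)

Section QuantumIntegers.
Variables (L : fieldType) (w : L).
Hypothesis w0 : w != 0.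
Hypothesis w_gen : forall a, (0 < a)%N -> w ^+ a.*2 != 1.

Lemma qint_den_neq0 : w - w^-1 != 0.
Proof.
rewrite subr_eq0; apply: contra (w_gen (isT : 0 < 1)%N) => /eqP e.
by rewrite expr2 {2}e mulfV.
Qed.

Lemma qint_neq0 a : (0 < a)%N -> qint w a != 0.
Proof.
move=> a0; rewrite mulf_neq0 ?invr_eq0 ?qint_den_neq0 // subr_eq0.
apply: contra (w_gen a0) => /eqP e.
by rewrite -addnn exprD {2}e mulfV // expf_neq0.
Qed.

Lemma qint0 : qint w 0 = 0.
Proof. by rewrite /qint expr0 invr1 subrr mul0r. Qed.

Lemma qfactS m : qfact w m.+1 = qfact w m * qint w m.+1.
Proof. by rewrite /qfact big_nat_recr. Qed.

Lemma qfact_neq0 m : qfact w m != 0.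
Proof.
elim: m => [|m IH]; first by rewrite /qfact big_geq // oner_eq0.
by rewrite qfactS mulf_neq0 ?qint_neq0.
Qed.

Lemma qbinom0 m : qbinom w m 0 = 1.
Proof. by rewrite /qbinom big_ord0 /qfact big_geq // divr1. Qed.

Lemma qbinom_small m d : (m < d)%N -> qbinom w m d = 0.
Proof.
move=> md; rewrite /qbinom (bigD1 (Ordinal md)) //=.
by rewrite subnn qint0 !mul0r.
Qed.

Lemma qbinomSr m d :
  qbinom w m d.+1 = qbinom w m d * (qint w (m - d) / qint w d.+1).
Proof.
rewrite /qbinom big_ord_recr /= qfactS.
have := qfact_neq0 d; have := qint_neq0 (ltn0Sn d).
move: (qint w d.+1) (qfact w d) (qint w _) (\prod_(i < d) _) => *; field.
exact/andP.
Qed.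

Lemma qbinomSS m d :
  qbinom w m.+1 d.+1 = qbinom w m d * (qint w m.+1 / qint w d.+1).
Proof.
rewrite /qbinom big_ord_recl /= qfactS subn0.
have := qfact_neq0 d; have := qint_neq0 (ltn0Sn d).
rewrite (eq_bigr (fun s : 'I_d => qint w (m - s))) //.
move: (qint w d.+1) (qfact w d) (qint w _) (\prod_(i < d) _) => *; field.
exact/andP.
Qed.

(** [qbinomSS] and [qbinomSr] express the two binomials of lower index d+1 through [qbinom w m d];
    what remains is [m+1] = w^-(d+1) [m-d] + w^(m-d) [d+1]. *)
Lemma qbinom_pascal m d : (d <= m)%N ->
  qbinom w m.+1 d.+1 = w ^- d.+1 * qbinom w m d.+1 + w ^+ (m - d) * qbinom w m d.
Proof.
move=> dm; rewrite qbinomSS qbinomSr.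
have -> : qint w m.+1 = w ^- d.+1 * qint w (m - d) + w ^+ (m - d) * qint w d.+1.
  rewrite /qint !mulrA -mulrDl; congr (_ / _).
  have -> : m.+1 = (m - d + d.+1)%N by rewrite addnS subnK.
  move: (m - d)%N (d.+1) => a b; rewrite exprD.
  have := expf_neq0 a w0; have := expf_neq0 b w0.
  move: (w ^+ a) (w ^+ b) => x y y0 x0.
  by field; rewrite x0 y0.
have := qint_neq0 (ltn0Sn d).
move: (qint w (m - d)) (qint w d.+1) (w ^- d.+1) (w ^+ (m - d)) (qbinom _ _ _) => *.
by field.
Qed.

End QuantumIntegers.

Section QuantumAdjoint.
Variables (L : fieldType) (A : algType L).
Implicit Types (Z z F : A) (x w y : L).

(** A product of the commuting operators z |-> Z z - x w^(2j) z Z, j < k. For w = v_i, k = N = 1 -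
    c_ij and x = w^(1-N), the scalars are v_i^m with m = c_ij, c_ij + 2, ..., -c_ij. *)
Fixpoint qad Z x w (k : nat) z : A :=
  if k is k'.+1 then
    Z * qad Z x w k' z - (x * w ^+ k'.*2) *: (qad Z x w k' z * Z)
  else z.

Lemma qadP Z x w k : linear (qad Z x w k).
Proof.
move=> a u v; elim: k => //= k ->.
rewrite !mulrDl !mulrDr !scalerDr opprD addrACA; congr (_ + _).
by rewrite -!scalerAl -!scalerAr scalerN !scalerA mulrC.
Qed.

HB.instance Definition _ Z x w k :=
  GRing.isLinear.Build L A A *:%R (qad Z x w k) (qadP Z x w k).


(** The commutator with F is a derivation that kills Z, so it passes through every factor of
    [qad]. *)
Lemma qad_comm Z x w k z F : Z * F = F * Z ->
  qad Z x w k z * F - F * qad Z x w k z = qad Z x w k (z * F - F * z).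
Proof.
move=> ZF; elim: k => //= k <-.
rewrite !(mulrBl, mulrBr) -!scalerAl -!scalerAr scalerBr !mulrA.
rewrite -[_ * Z * F]mulrA ZF !mulrA.
rewrite opprB opprD opprK -!addrA; congr (_ + _).
by rewrite addrA addrC.
Qed.

(** The factor of index j sends z Z^j to (y - x w^(2j)) z Z^(j+1); a single vanishing scalar kills
    the whole product. *)
Lemma qad_eigenE Z x w k z y : Z * z = y *: (z * Z) ->
  qad Z x w k z = (\prod_(j < k) (y - x * w ^+ j.*2)) *: (z * Z ^+ k).
Proof.
move=> Zz; elim: k => [|k IH] /=; first by rewrite big_ord0 scale1r mulr1.
rewrite IH -scalerAr -scalerAl mulrA Zz -scalerAl -!mulrA -exprS -exprSr.
by rewrite !scalerA -scalerBl big_ord_recr /=; congr (_ *: _); ring.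
Qed.

Lemma qad_eigen0 Z x w k m z : (m < k)%N ->
  Z * z = (x * w ^+ m.*2) *: (z * Z) -> qad Z x w k z = 0.
Proof.
move=> mk /(@qad_eigenE _ x w k) ->.
by rewrite (bigD1 (Ordinal mk)) //= subrr mul0r scale0r.
Qed.

(** The q-binomial theorem for left and right multiplication by Z, which commute; the coefficients
    obey the q-Pascal rule. *)
Lemma qad_sum Z x w k z :
    w != 0 -> (forall a, (0 < a)%N -> w ^+ a.*2 != 1) ->
  qad Z x w k z =
  \sum_(t < k.+1) ((-1) ^+ t * qbinom w k t * (x / w) ^+ t * w ^+ (t * k))
                    *: (Z ^+ (k - t) * z * Z ^+ t).
Proof.
move=> w0 wg.
pose c m t := (-1) ^+ t * qbinom w m t * (x / w) ^+ t * w ^+ (t * m).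
have c0 m : c m 0 = 1 by rewrite /c qbinom0 !mulr1.
(* The zero at t = m + 1 allows the left-multiplication sum to run over all m + 2 indices of the
   next stage. *)
have cmm m : c m m.+1 = 0 by rewrite /c qbinom_small // mulr0 !mul0r.
have cS m t : (t <= m)%N -> c m.+1 t.+1 = c m t.+1 - x * w ^+ m.*2 * c m t.
  move=> tk; rewrite /c qbinom_pascal //.
  have -> : w ^+ (t.+1 * m.+1) = w ^+ (t * m) * w ^+ t * w ^+ m * w.
    by rewrite -!exprD -exprSr; congr (_ ^+ _); nia.
  have -> : w ^+ (t.+1 * m) = w ^+ (t * m) * w ^+ m.
    by rewrite -!exprD; congr (_ ^+ _); nia.
  rewrite -addnn exprD !exprS.
  have -> : w ^+ m = w ^+ (m - t) * w ^+ t by rewrite -exprD subnK.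
  have := expf_neq0 t w0; move: w0.
  move: (w ^+ (m - t)) (w ^+ t) (w ^+ (t * m)) (qbinom w m t.+1) (qbinom w m t).
  move: ((-1) ^+ t) ((x / w) ^+ t) => *; field.
  by apply/andP; split.
suff H m : qad Z x w m z =
    \sum_(t < m.+1) c m t *: (Z ^+ (m - t) * z * Z ^+ t) by exact: H.
elim: m => [|m IH] /=; first by rewrite big_ord1 c0 !mulr1 mul1r scale1r.
transitivity (\sum_(t < m.+2) c m t *: (Z ^+ (m.+1 - t) * z * Z ^+ t) -
  \sum_(t < m.+1) (x * w ^+ m.*2 * c m t) *: (Z ^+ (m - t) * z * Z ^+ t.+1)).
  congr (_ - _).
    rewrite big_ord_recr /= cmm scale0r addr0 IH mulr_sumr.
    apply: eq_bigr => t _; rewrite -scalerAr !mulrA -exprS subSn //.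
    by rewrite -ltnS.
  rewrite IH mulr_suml scaler_sumr; apply: eq_bigr => t _.
  by rewrite -scalerAl scalerA exprSr mulrA.
rewrite !(big_ord_recl m.+1) /= !c0 -addrA; congr (_ + _).
rewrite -sumrB; apply: eq_bigr => t _; rewrite subSS cS ?scalerBl //.
by rewrite -ltnS.
Qed.

(** With x = w^(1-N) the powers (x / w)^t and w^(t N) cancel, which leaves the plain Serre
    coefficients. *)
Lemma serre_sumE n (vs : 'I_n -> L) (C : 'M[int]_n) (Z : 'I_n -> A) i j
    (N := `|(1 - C i j)%R|%N) :
    vs i != 0 -> (forall a, (0 < a)%N -> vs i ^+ a.*2 != 1) ->
  \sum_(t < N.+1)
     ((-1) ^+ t * qbinom (vs i) N t) *: (Z i ^+ (N - t) * Z j * Z i ^+ t)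
  = qad (Z i) (vs i * vs i ^- N) (vs i) N (Z j).
Proof.
move=> w0 wg; rewrite qad_sum //; apply: eq_bigr => t _; congr (_ *: _).
rewrite [vs i * _]mulrC mulfK // exprVn mulnC exprM mulfVK //.
by rewrite !expf_neq0.
Qed.

Lemma qad_commK Z x w k z K y y' :
  K * Z = y *: (Z * K) -> K * z = y' *: (z * K) ->
  K * qad Z x w k z = (y' * y ^+ k) *: (qad Z x w k z * K).
Proof.
move=> KZ Kz; elim: k => [|k IH] /=; first by rewrite mulr1.
rewrite mulrBr mulrBl -scalerAl -scalerAr scalerBr; congr (_ - _).
  rewrite mulrA KZ -scalerAl -[Z * K * _]mulrA IH -scalerAr scalerA mulrA.
  by rewrite mulrA exprS; congr (_ *: _); ring.
rewrite [K * _]mulrA IH -scalerAl -[_ * K * _]mulrA KZ -scalerAr !scalerA !mulrA.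
by congr (_ *: _); rewrite exprS; ring.
Qed.

End QuantumAdjoint.

(** * Commutators of Serre elements with the opposite generators *)

Section SerreCommutation.
Variables (L : fieldType) (A : algType L).

(** The induction step for the commutator of F with [qad]: zp and z are two successive stages and m
    is the next scalar. The last premise, that z comes from zp, is multiplied by g so that it also
    covers the initial stage, where g = 0 and there is no predecessor. *)
Lemma qad_sl2_step (E F K K' z zp : A) (kap g w m : L) :
    w != 0 -> m != 0 ->
    E * F - F * E = kap *: (K - K') ->
    K * z = m *: (z * K) -> K' * z = m^-1 *: (z * K') ->
    E * K' = w ^+ 2 *: (K' * E) ->
    z * F - F * z = g *: (zp * K') ->
    g *: z = g *: (E * zp - (m * w ^- 2) *: (zp * E)) ->
  (E * z - m *: (z * E)) * F - F * (E * z - m *: (z * E)) =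
    (g + kap * (m - m^-1)) *: (z * K').
Proof.
move=> w0 m0 EF Kz K'z EK' zF zE.
have K'E : K' * E = w ^- 2 *: (E * K').
  by rewrite EK' scalerA mulVf ?scale1r // expf_neq0.
have eEF : E * F = F * E + kap *: (K - K') by rewrite -EF addrC subrK.
have ezF : z * F = F * z + g *: (zp * K') by rewrite -zF addrC subrK.
have T1 : E * z * F = F * E * z + kap *: (m *: (z * K) - m^-1 *: (z * K'))
                      + g *: (E * zp * K').
  rewrite -mulrA ezF mulrDr mulrA eEF mulrDl -scalerAl mulrBl Kz K'z.
  by rewrite -scalerAr mulrA.
have T2 : z * E * F = F * z * E + (g * w ^- 2) *: (zp * E * K')
                      + kap *: (z * K - z * K').
  rewrite -mulrA eEF mulrDr mulrA ezF mulrDl -scalerAr mulrBr.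
  by rewrite -scalerAl -[zp * K' * E]mulrA K'E -scalerAr scalerA !mulrA.
have T3 : g *: (E * zp * K') = g *: (z * K') + (m * (g * w ^- 2)) *: (zp * E * K').
  have := congr1 (fun u => u * K') zE.
  rewrite /= -!scalerAl => ->; rewrite mulrBl -scalerAl scalerBr scalerA.
  by rewrite mulrCA mulrA subrK.
rewrite mulrBl mulrBr -scalerAl -scalerAr T1 T2 T3 !mulrA.
rewrite !scalerDr !scalerN !scalerA.
move: (F * E * z) (F * z * E) (z * K) (z * K') (zp * E * K') => a b c d e.
rewrite !(mulrBr, scalerBl, scalerDl, opprD, opprK, scalerA).
rewrite [kap * m]mulrC mulrA !addrA.
(* Of the eleven terms four pairs cancel; the three multiples of z K' remain. *)
rewrite [LHS](ACl ((1*10)*(2*8)*(6*11)*(5*7)*(4*(9*3))))%AC /=.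
by rewrite !subrr addNr !add0r !addrA.
Qed.

(** The commutator of stage k with F is g_k times stage k-1 times K', where g_k sums kap (m_j - 1 /
    m_j) over j < k. For k = N the scalars m_j = w^(1-N+2j) are permuted by inversion, so g_N =
    0. *)
Lemma qad_sl2_comm (E F K K' z : A) (w : L) (N : nat) :
    w != 0 ->
    E * F - F * E = (w - w^-1)^-1 *: (K - K') ->
    K * E = w ^+ 2 *: (E * K) -> E * K' = w ^+ 2 *: (K' * E) ->
    K * z = (w * w ^- N) *: (z * K) -> K' * z = (w * w ^- N)^-1 *: (z * K') ->
    z * F = F * z ->
  qad E (w * w ^- N) w N z * F = F * qad E (w * w ^- N) w N z.
Proof.
move=> w0; set x := w * _; set kap := _^-1 => EF KE EK' Kz K'z zF.
have x0 : x != 0 by rewrite mulf_neq0 ?invr_eq0 ?expf_neq0.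
have K'E : K' * E = w ^- 2 *: (E * K').
  by rewrite EK' scalerA mulVf ?scale1r // expf_neq0.
pose m j := x * w ^+ j.*2.
have m0 j : m j != 0 by rewrite mulf_neq0 ?expf_neq0.
have Kq j : K * qad E x w j z = m j *: (qad E x w j z * K).
  by rewrite (qad_commK _ _ _ KE Kz) -exprM mul2n.
have K'q j : K' * qad E x w j z = (m j)^-1 *: (qad E x w j z * K').
  by rewrite (qad_commK _ _ _ K'E K'z) [in RHS]invfM exprVn -exprM mul2n.
pose g k := \sum_(j < k) kap * (m j - (m j)^-1).
have H k : qad E x w k z * F - F * qad E x w k z
            = g k *: (qad E x w k.-1 z * K').
  elim: k => [|k IH]; first by rewrite /g big_ord0 scale0r /= zF subrr.
  rewrite /g big_ord_recr /= -/(g k).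
  apply: (qad_sl2_step w0 (m0 k) EF (Kq k) (K'q k) EK' IH).
  case: k {IH} => [|k]; first by rewrite /g big_ord0 !scale0r.
  by rewrite /m doubleS -[_.+2]addn2 exprD mulrA mulfK ?expf_neq0.
apply/eqP; rewrite -subr_eq0 H.
suff -> : g N = 0 by rewrite scale0r.
(* The reversal j |-> N - 1 - j carries m_j to its inverse. *)
rewrite /g -mulr_sumr sumrB [X in _ - X](reindex_inj rev_ord_inj) /=.
apply/eqP; rewrite mulf_eq0 subr_eq0; apply/orP; right; apply/eqP.
apply: eq_bigr => j _.
rewrite /m /x; have := ltn_ord j.
move: (nat_of_ord j) => i; rewrite -addnn -addnn => iN.
have -> : w ^- N = w ^- i * w ^- (N - i.+1) * w^-1.
  by rewrite -!invfM -exprD -exprSr; congr (_ ^- _); lia.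
have := expf_neq0 i w0; have := expf_neq0 (N - i.+1) w0; rewrite !exprD.
move: (w ^+ i) (w ^+ (N - i.+1)) => *; field.
by repeat (apply/andP; split).
Qed.

End SerreCommutation.

(** * The quantum group before the Serre relations are imposed *)

Section QuantumGroupWithoutSerre.
Variables (L : fieldType) (n : nat) (vs : 'I_n -> L) (C : 'M[int]_n).

Definition serre_elt (U : algType L) (Z : 'I_n -> U) (i j : 'I_n) : U :=
  let N := `|(1 - C i j)%R|%N in
  \sum_(t < N.+1)
     ((-1) ^+ t * qbinom (vs i) N t) *: (Z i ^+ (N - t) * Z j * Z i ^+ t).

Record Uv_pre (U : algType L) (E F K K' : 'I_n -> U) : Prop := UvPre {
  pre_KK' : forall i, K i * K' i = 1;
  pre_K'K : forall i, K' i * K i = 1;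
  pre_KC : forall i j, K i * K j = K j * K i;
  pre_KE : forall i j, K i * E j = vs i ^ C i j *: (E j * K i);
  pre_KF : forall i j, K i * F j = vs i ^ (- C i j) *: (F j * K i);
  pre_EF : forall i,
    E i * F i - F i * E i = (vs i - (vs i)^-1)^-1 *: (K i - K' i);
  pre_EFC : forall i j, i != j -> E i * F j = F j * E i
}.

(** [Csym] is the symmetrizability of C in exponential form. *)
Hypotheses (vs0 : forall i, vs i != 0)
  (vs_gen : forall i a, (0 < a)%N -> vs i ^+ a.*2 != 1)
  (Cdiag : forall i, C i i = 2) (Coff : forall i j, i != j -> C i j <= 0)
  (Csym : forall i j, vs i ^ C i j = vs j ^ C j i).

Lemma conj_inv (U : algType L) (K K' Z : U) (c : L) :
  K * K' = 1 -> K' * K = 1 -> K * Z = c *: (Z * K) -> Z * K' = c *: (K' * Z).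
Proof.
move=> KK' K'K /(congr1 (fun u => K' * u * K')).
by rewrite /= mulrA K'K mul1r -scalerAr -scalerAl mulrA -!mulrA KK' mulr1.
Qed.

Section Pre.
Variables (U : algType L) (E F K K' : 'I_n -> U).
Hypothesis pre : Uv_pre E F K K'.

Lemma pre_EK' i j : E j * K' i = vs i ^ C i j *: (K' i * E j).
Proof. exact: conj_inv (pre_KK' pre i) (pre_K'K pre i) (pre_KE pre i j). Qed.

Lemma pre_FK' i j : F j * K' i = vs i ^ (- C i j) *: (K' i * F j).
Proof. exact: conj_inv (pre_KK' pre i) (pre_K'K pre i) (pre_KF pre i j). Qed.

Lemma pre_K'E i j : K' i * E j = vs i ^ (- C i j) *: (E j * K' i).
Proof. by rewrite pre_EK' scalerA -expfzDr // addNr scale1r. Qed.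

Lemma pre_K'F i j : K' i * F j = vs i ^ C i j *: (F j * K' i).
Proof. by rewrite pre_FK' scalerA -expfzDr // subrr scale1r. Qed.

(** The Chevalley involution; it transfers results on the Serre elements in E to those in F. *)
Lemma Uv_pre_sym : Uv_pre F E K' K.
Proof.
split=> [i|i|i j|i j|i j|i|i j ij].
- exact: pre_K'K pre i.
- exact: pre_KK' pre i.
- have c1 a b : K a * K' b = 1 *: (K' b * K a).
    rewrite -(conj_inv (pre_KK' pre b) (pre_K'K pre b) (Z := K a) (c := 1)) //.
    by rewrite scale1r (pre_KC pre).
  by rewrite (conj_inv (pre_KK' pre j) (pre_K'K pre j) (c1 j i)) scale1r.
- exact: pre_K'F.
- exact: pre_K'E.
- by rewrite -opprB (pre_EF pre) -scalerN opprB.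
- by rewrite (pre_EFC pre) // eq_sym.
Qed.

Lemma serre_exp i j : i != j ->
  vs i ^ C i j = vs i * vs i ^- `|(1 - C i j)%R|%N.
Proof.
move=> ij; rewrite exprnN -[X in X * _]expr1z -expfzDr //.
by congr (_ ^ _); have := Coff ij; lia.
Qed.

(** For k = i this is the rank one computation [qad_sl2_comm]. Otherwise F_k commutes with E_i, and
    only its commutator with E_j matters: it is zero unless k = j, and then a combination of K_j and
    its inverse. *)
Lemma serre_comm i j k : i != j -> serre_elt E i j * F k = F k * serre_elt E i j.
Proof.
move=> ij; rewrite /serre_elt serre_sumE //.
have := serre_exp ij; set N := `|_|%N => xE.
have N0 : (0 < N)%N by rewrite /N; have := Coff ij; lia.
have [<-|ki] := eqVneq i k.
  apply: qad_sl2_comm (vs0 i) (pre_EF pre i) _ _ _ _ _.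
  - by rewrite (pre_KE pre) Cdiag.
  - by rewrite pre_EK' Cdiag.
  - by rewrite (pre_KE pre) xE.
  - by rewrite pre_K'E -xE invr_expz.
  - by rewrite (pre_EFC pre) // eq_sym.
apply/eqP; rewrite -subr_eq0 (qad_comm _ _ _ _ (pre_EFC pre ki)).
have [<-|kj] := eqVneq j k; last by rewrite (pre_EFC pre) // subrr linear0.
rewrite (pre_EF pre) linearZ linearB /=.
(* The last factor of [qad] kills K_j and the first one kills its inverse. *)
rewrite (@qad_eigen0 _ _ _ _ _ _ N.-1) ?(@qad_eigen0 _ _ _ _ _ _ 0%N) //.
- by rewrite subrr scaler0.
- by rewrite mulr1 -xE pre_EK' -Csym.
- by rewrite prednK.
- apply/esym; rewrite (pre_KE pre) scalerA -Csym xE.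
  suff -> : vs i / vs i ^+ N * vs i ^+ N.-1.*2 * (vs i / vs i ^+ N) = 1.
    by rewrite scale1r.
  rewrite -(prednK N0) /= -addnn exprD !exprS.
  have := expf_neq0 N.-1 (vs0 i); have := vs0 i.
  move: (vs i) (_ ^+ _) => a b a0 b0; field; exact/andP.
exact: vs_gen.
Qed.

End Pre.
End QuantumGroupWithoutSerre.

(** * The presentation of the positive part *)

Section Endomorphisms.
Variables (L : fieldType) (V : lmodType L) (hV : exists x : V, x != 0).

(* [hV] only serves to make the endomorphism ring nontrivial. *)
Record endo (h : exists x : V, x != 0) := Endo {
  endo_fun :> V -> V;
  endo_lin : linear endo_fun
}.

Local Notation T := (endo hV).

HB.instance Definition _ := gen_eqMixin T.
HB.instance Definition _ := gen_choiceMixin T.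
HB.instance Definition _ (f : T) :=
  GRing.isLinear.Build L V V *:%R (endo_fun f) (endo_lin f).

Lemma endoP (f g : T) : (forall x, f x = g x) -> f = g.
Proof.
case: f g => [f lf] [g lg] /= /funext fg; subst g.
by rewrite (Prop_irrelevance lf lg).
Qed.

Let zero_lin : linear (fun _ : V => 0 : V).
Proof. by move=> a u v; rewrite scaler0 addr0. Qed.
Let add_lin (f g : T) : linear (fun x => f x + g x).
Proof. by move=> a u v; rewrite !linearP scalerDr addrACA. Qed.
Let opp_lin (f : T) : linear (fun x => - f x).
Proof. by move=> a u v; rewrite linearP opprD scalerN. Qed.
Let one_lin : linear (fun x : V => x).
Proof. by []. Qed.
Let mul_lin (f g : T) : linear (fun x => f (g x)).
Proof. by move=> a u v; rewrite !linearP. Qed.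
Let scale_lin c (f : T) : linear (fun x => c *: f x).
Proof. by move=> a u v; rewrite linearP scalerDr !scalerA mulrC. Qed.

Let zero : T := Endo hV zero_lin.
Let add (f g : T) : T := Endo hV (add_lin f g).
Let opp (f : T) : T := Endo hV (opp_lin f).
Let one : T := Endo hV one_lin.
Let mul (f g : T) : T := Endo hV (mul_lin f g).
Let scale c (f : T) : T := Endo hV (scale_lin c f).

Let addA : associative add.
Proof. by move=> f g h; apply: endoP => x /=; rewrite addrA. Qed.
Let addC : commutative add.
Proof. by move=> f g; apply: endoP => x /=; rewrite addrC. Qed.
Let add0 : left_id zero add.
Proof. by move=> f; apply: endoP => x /=; rewrite add0r. Qed.
Let addN : left_inverse zero opp add.
Proof. by move=> f; apply: endoP => x /=; rewrite addNr. Qed.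
HB.instance Definition _ := GRing.isZmodule.Build T addA addC add0 addN.

Let mulA : associative mul.
Proof. by move=> f g h; apply: endoP. Qed.
Let mul1l : left_id one mul.
Proof. by move=> f; apply: endoP. Qed.
Let mul1r : right_id one mul.
Proof. by move=> f; apply: endoP. Qed.
Let mulDl : left_distributive mul +%R.
Proof. by move=> f g h; apply: endoP. Qed.
Let mulDr : right_distributive mul +%R.
Proof. by move=> f g h; apply: endoP => x /=; rewrite linearD. Qed.
Let one_neq0 : one != 0.
Proof.
have [x x0] := hV.
by apply: contra x0 => /eqP /(congr1 (fun f : T => f x)) /= ->.
Qed.
HB.instance Definition _ := GRing.Zmodule_isNzRing.Build T
  mulA mul1l mul1r mulDl mulDr one_neq0.

Let scaleA a b f : scale a (scale b f) = scale (a * b) f.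
Proof. by apply: endoP => x /=; rewrite scalerA. Qed.
Let scale1 : left_id 1 scale.
Proof. by move=> f; apply: endoP => x /=; rewrite scale1r. Qed.
Let scaleDr : right_distributive scale +%R.
Proof. by move=> a f g; apply: endoP => x /=; rewrite scalerDr. Qed.
Let scaleDl f : {morph scale^~ f : a b / a + b}.
Proof. by move=> a b; apply: endoP => x /=; rewrite scalerDl. Qed.
HB.instance Definition _ :=
  GRing.Zmodule_isLmodule.Build L T scaleA scale1 scaleDr scaleDl.

Let scaleAl a (f g : T) : a *: (f * g) = (a *: f) * g.
Proof. by apply: endoP. Qed.
Let scaleAr a (f g : T) : a *: (f * g) = f * (a *: g).
Proof. by apply: endoP => x /=; rewrite [RHS]linearZ. Qed.
HB.instance Definition _ := GRing.Lmodule_isLalgebra.Build L T scaleAl.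
HB.instance Definition _ := GRing.Lalgebra_isAlgebra.Build L T scaleAr.

Lemma endo0 (f : T) : f 0 = 0. Proof. exact: linear0. Qed.
Lemma endoZ (f : T) a x : f (a *: x) = a *: f x. Proof. exact: linearZ. Qed.
Lemma endoD (f : T) x y : f (x + y) = f x + f y. Proof. exact: linearD. Qed.
Lemma endo_mulE (f g : T) x : (f * g) x = f (g x). Proof. by []. Qed.
Lemma endo_addE (f g : T) x : (f + g) x = f x + g x. Proof. by []. Qed.
Lemma endo_oppE (f : T) x : (- f) x = - f x. Proof. by []. Qed.
Lemma endo_scaleE c (f : T) x : (c *: f) x = c *: f x. Proof. by []. Qed.
Lemma endo_sumE I r (P : pred I) (F : I -> T) x :
  (\sum_(i <- r | P i) F i) x = \sum_(i <- r | P i) F i x.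
Proof. by elim/big_rec2: _ => // i u v _ <-. Qed.

End Endomorphisms.

(** * The representation on functions of words, and its Serre-compatible part *)

Section WordFunctions.
Variables (L : fieldType) (A : algType L) (n : nat).
Variables (vs : 'I_n -> L) (C : 'M[int]_n).
Hypotheses (vs0 : forall i, vs i != 0)
  (vs_gen : forall i a, (0 < a)%N -> vs i ^+ a.*2 != 1)
  (Cdiag : forall i, C i i = 2) (Coff : forall i j, i != j -> C i j <= 0)
  (Csym : forall i j, vs i ^ C i j = vs j ^ C j i).

Local Notation Phi := (seq 'I_n -> A).

Lemma wordfun_neq0 : exists f : Phi, f != 0.
Proof.
exists (fun=> 1); apply/eqP => /(congr1 (fun f : Phi => f [::])) /eqP.
by rewrite oner_eq0.
Qed.

Local Notation T := (endo wordfun_neq0).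

(** The exponent is negative because [wE j] strips a letter: its value at w is the value of f at j
    w. *)
Definition weight (i : 'I_n) (w : seq 'I_n) : L := \prod_(j <- w) vs i ^ (- C i j).

Lemma weight_neq0 i w : weight i w != 0.
Proof. by rewrite prodf_seq_neq0; apply/allP => j _; rewrite expfz_neq0. Qed.

Definition consE_fun (j : 'I_n) (f : Phi) : Phi := fun w => f (j :: w).
Definition weightK_fun (i : 'I_n) (f : Phi) : Phi := fun w => weight i w *: f w.
Definition weightK'_fun (i : 'I_n) (f : Phi) : Phi := fun w => (weight i w)^-1 *: f w.

(* The value at the empty word is 0, and the other values are forced by the
   relation between E_j and F_i. *)
Fixpoint shuffleF_fun (i : 'I_n) (f : Phi) (w : seq 'I_n) : A :=
  if w is j :: w' then
    shuffleF_fun i (consE_fun j f) w' +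
      (if j == i then
         (vs i - (vs i)^-1)^-1 *: (weightK_fun i f w' - weightK'_fun i f w')
       else 0)
  else 0.

Lemma fct_linE a (f g : Phi) w : (a *: f + g) w = a *: f w + g w.
Proof. by []. Qed.

Lemma consE_lin j : linear (consE_fun j).
Proof. by move=> a f g; apply/funext. Qed.

Lemma weightK_lin i : linear (weightK_fun i).
Proof.
move=> a f g; apply/funext => w; rewrite fct_linE /weightK_fun fct_linE.
by rewrite scalerDr !scalerA mulrC.
Qed.

Lemma weightK'_lin i : linear (weightK'_fun i).
Proof.
move=> a f g; apply/funext => w; rewrite fct_linE /weightK'_fun fct_linE.
by rewrite scalerDr !scalerA mulrC.
Qed.

Lemma shuffleF_lin i : linear (shuffleF_fun i).
Proof.
move=> a f g; apply/funext => w; rewrite fct_linE.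
elim: w f g => [|j w IH] f g /=; first by rewrite scaler0 addr0.
rewrite consE_lin IH weightK_lin weightK'_lin !fct_linE.
case: ifP => _; last by rewrite !addr0.
rewrite opprD addrACA -scalerN -!scalerDr scalerDr [X in _ + _ + X]scalerDr.
by rewrite addrACA !scalerDr !scalerA !(mulrC a).
Qed.

Definition wE j : T := Endo wordfun_neq0 (consE_lin j).
Definition wK i : T := Endo wordfun_neq0 (weightK_lin i).
Definition wK' i : T := Endo wordfun_neq0 (weightK'_lin i).
Definition wF i : T := Endo wordfun_neq0 (shuffleF_lin i).

Lemma fct_scaleE a (f : Phi) w : (a *: f) w = a *: f w. Proof. by []. Qed.
Lemma wE_E j f w : wE j f w = f (j :: w). Proof. by []. Qed.
Lemma wK_E i f w : wK i f w = weight i w *: f w. Proof. by []. Qed.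
Lemma wK'_E i f w : wK' i f w = (weight i w)^-1 *: f w. Proof. by []. Qed.
Lemma wF_nil i f : wF i f [::] = 0. Proof. by []. Qed.
Lemma wF_cons i j f w : wF i f (j :: w) = wF i (wE j f) w +
  (if j == i then (vs i - (vs i)^-1)^-1 *: (wK i f w - wK' i f w) else 0).
Proof. by []. Qed.

Lemma weight_cons i j w : weight i (j :: w) = vs i ^ (- C i j) * weight i w.
Proof. by rewrite /weight big_cons. Qed.

Lemma wKE i j : wK i * wE j = vs i ^ C i j *: (wE j * wK i).
Proof.
apply: endoP => f; apply/funext => w.
rewrite endo_scaleE fct_scaleE !endo_mulE wE_E !wK_E wE_E.
by rewrite weight_cons scalerA mulrA -expfzDr // subrr mul1r.
Qed.

Lemma wEK i j : wE j * wK i = vs i ^ (- C i j) *: (wK i * wE j).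
Proof. by rewrite wKE scalerA -expfzDr // addNr scale1r. Qed.

Lemma wKC i j : wK i * wK j = wK j * wK i.
Proof.
apply: endoP => f; apply/funext => w.
by rewrite !endo_mulE !wK_E !scalerA mulrC.
Qed.

(** Induction on the word with f left general, since the recursion for [wF] replaces f by
    [wE k f]. *)
Lemma wKF i j : wK i * wF j = vs i ^ (- C i j) *: (wF j * wK i).
Proof.
apply: endoP => f; apply/funext => w; rewrite endo_scaleE fct_scaleE !endo_mulE.
elim: w f => [|k w IH] f; first by rewrite wK_E !wF_nil !scaler0.
have EK : wE k (wK i f) = vs i ^ (- C i k) *: wK i (wE k f).
  by have := congr1 (fun X : T => X f) (wEK i k).
rewrite wK_E !wF_cons weight_cons -scalerA [weight i w *: _]scalerDr -wK_E IH.
rewrite EK endoZ fct_scaleE !scalerDr !scalerA [vs i ^ (- C i k) * vs _ ^ _]mulrC.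
congr (_ + _); case: eqP => [->|_]; last by rewrite !scaler0.
rewrite !wK'_E !wK_E !scalerN !scalerA -!scalerBl !scalerA.
by congr (_ *: _); ring.
Qed.

Lemma wpre : Uv_pre vs C wE wF wK wK'.
Proof.
split=> [i|i|i j|i j|i j|i|i j ij].
- apply: endoP => f; apply/funext => w; rewrite endo_mulE wK_E wK'_E.
  by rewrite scalerA mulfV ?scale1r ?weight_neq0.
- apply: endoP => f; apply/funext => w; rewrite endo_mulE wK'_E wK_E.
  by rewrite scalerA mulVf ?scale1r ?weight_neq0.
- exact: wKC.
- exact: wKE.
- exact: wKF.
- apply: endoP => f; apply/funext => w; rewrite endo_scaleE fct_scaleE.
  rewrite endo_addE endo_oppE !endo_mulE fctE wE_E wF_cons eqxx.
  by rewrite addrC addKr.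
- apply: endoP => f; apply/funext => w.
  by rewrite !endo_mulE wE_E wF_cons (negPf ij) addr0.
Qed.

(** The Serre element in F commutes with every [wE k], so its value at any word reduces to a value
    at the empty word; there each term vanishes because its outermost operator is some [wF]. *)
Lemma serreF_word i j : i != j -> serre vs C wF i j.
Proof.
move=> ij; apply: endoP => f; apply/funext => w; rewrite -/(serre_elt vs C wF i j).
have cE k : serre_elt vs C wF i j * wE k = wE k * serre_elt vs C wF i j.
  exact: (serre_comm vs0 vs_gen Cdiag Coff Csym (Uv_pre_sym vs0 wpre)).
elim: w f => [|k w IH] f; last first.
  have : (serre_elt vs C wF i j * wE k) f w = (wE k * serre_elt vs C wF i j) f w.
    by rewrite cE.
  by rewrite !endo_mulE IH wE_E => <-.
rewrite /serre_elt endo_sumE fct_sumE big1 // => t _.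
rewrite endo_scaleE fct_scaleE.
by case: (_ - _)%N => [|m]; rewrite ?mul1r ?exprS !endo_mulE wF_nil scaler0.
Qed.

(** Holding for all b, this says that f, extended linearly to the free algebra, kills the two-sided
    Serre ideal: b is the factor on one side of the Serre element and the argument of the resulting
    function is the factor on the other. *)
Fixpoint serre_null (b : seq 'I_n) (f : Phi) : Prop :=
  if b is j :: b' then serre_null b' (wE j f)
  else forall i j, i != j -> serre_elt vs C wE i j f = 0.

Definition serre_dual : {pred Phi} := fun f => `[< forall b, serre_null b f >].

Lemma serre_null_lin b a f g :
  serre_null b f -> serre_null b g -> serre_null b (a *: f + g).
Proof.
elim: b f g => [|j b IH] f g /= hf hg; last first.
  by rewrite consE_lin; apply: IH.
by move=> i j ij; rewrite endoD endoZ hf // hg // scaler0 addr0.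
Qed.

Lemma serre_null0 b : serre_null b 0.
Proof. by elim: b => [|j b IH] //= i j _; rewrite endo0. Qed.

Lemma serre_dual_closed : submod_closed serre_dual.
Proof.
split=> [|a f g]; rewrite !unfold_in.
  by apply/asboolP => b; exact: serre_null0.
move=> /asboolP hf /asboolP hg; apply/asboolP => b.
exact: serre_null_lin.
Qed.

HB.instance Definition _ := GRing.isSubmodClosed.Build L Phi serre_dual
  (GRing.submod_closed_semi serre_dual_closed).

Lemma wE_dual j f : f \in serre_dual -> wE j f \in serre_dual.
Proof. by move=> /asboolP h; apply/asboolP => b; exact: (h (j :: b)). Qed.

Lemma dual_serre i j f : f \in serre_dual -> i != j -> serre_elt vs C wE i j f = 0.
Proof. by move=> /asboolP /(_ [::]); apply. Qed.

(** X commutes with each [wE j] up to a nonzero scalar, hence also with the Serre elements, which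
    are homogeneous. *)
Lemma diagonal_dual (X : T) (a : 'I_n -> L) f : (forall j, a j != 0) ->
    (forall j, X * wE j = a j *: (wE j * X)) ->
  f \in serre_dual -> X f \in serre_dual.
Proof.
move=> a0 aP /asboolP hf; apply/asboolP => b.
elim: b f {hf}(hf b) => [|j b IH] f /= hf; last first.
  have -> : consE_fun j (X f) = (a j)^-1 *: X (wE j f) + 0.
    transitivity ((a j)^-1 *: (X * wE j) f); last by rewrite addr0.
    by rewrite aP endo_scaleE scalerA mulVf ?scale1r.
  by apply: serre_null_lin (serre_null0 b); exact: IH.
move=> i j ij; have := hf i j ij.
rewrite /serre_elt serre_sumE //; last exact: vs_gen.
set x := vs i / _; set N := `|_|%N => h.
have := congr1 (fun Y : T => Y f) (qad_commK x (vs i) N (aP i) (aP j)).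
rewrite endo_scaleE !endo_mulE h endo0 => /esym/eqP.
by rewrite scaler_eq0 mulf_eq0 (negPf (a0 j)) expf_eq0 (negPf (a0 i)) andbF => /eqP.
Qed.

Lemma wK_dual i f : f \in serre_dual -> wK i f \in serre_dual.
Proof.
by apply: diagonal_dual (fun j => expfz_neq0 (C i j) (vs0 i)) (wKE i).
Qed.

Lemma wK'_dual i f : f \in serre_dual -> wK' i f \in serre_dual.
Proof.
apply: diagonal_dual (fun j => expfz_neq0 (- C i j) (vs0 i)) _.
exact: (pre_K'E vs0 wpre).
Qed.

(** At the empty word this is [serre_comm]. A further letter j is moved past [wF i] at the cost of
    terms in [wK i] and [wK' i], which preserve the subspace. *)
Lemma wF_dual i f : f \in serre_dual -> wF i f \in serre_dual.
Proof.
move=> hf; apply/asboolP => b; elim: b f hf => [|j b IH] f hf.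
  move=> a c ac; rewrite -endo_mulE.
  rewrite (serre_comm vs0 vs_gen Cdiag Coff Csym wpre) // endo_mulE.
  by rewrite dual_serre // endo0.
change (serre_null b (wE j (wF i f))).
have -> : wE j (wF i f) = wF i (wE j f) +
    (if j == i then (vs i - (vs i)^-1)^-1 *: (wK i f - wK' i f) else 0).
  by apply/funext => w; rewrite wE_E wF_cons; case: eqP.
rewrite -[wF i _]scale1r; apply: serre_null_lin; first exact/IH/wE_dual.
case: eqP => _; last exact: serre_null0.
have : (vs i - (vs i)^-1)^-1 *: (wK i f - wK' i f) \in serre_dual.
  by rewrite rpredZ // rpredB ?wK_dual ?wK'_dual.
by move=> /asboolP.
Qed.

Record serre_dualmod := SerreDual { dual_val : Phi; _ : dual_val \in serre_dual }.

HB.instance Definition _ := [isSub for dual_val].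
HB.instance Definition _ := [Choice of serre_dualmod by <:].
HB.instance Definition _ := [SubChoice_isSubLmodule of serre_dualmod by <:].

Lemma dual_valZ a (x : serre_dualmod) : val (a *: x) = a *: val x :> Phi.
Proof. exact: linearZ. Qed.

Section Restriction.
Hypothesis hN : exists x : serre_dualmod, x != 0.

Section RestrictOne.
Variables (X : T) (hX : forall f, f \in serre_dual -> X f \in serre_dual).

Definition restrict_fun (x : serre_dualmod) : serre_dualmod :=
  SerreDual (hX (valP x)).

Lemma restrict_lin : linear restrict_fun.
Proof.
move=> a x y; apply: val_inj.
by rewrite [RHS]linearP /= linearP.
Qed.

Definition restrict : endo hN := Endo hN restrict_lin.

Lemma restrictE x : val (restrict x) = X (val x). Proof. by []. Qed.

Lemma restrictXE m x : val ((restrict ^+ m) x) = (X ^+ m) (val x).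
Proof. by elim: m x => [|m IH] x //; rewrite !exprS !endo_mulE restrictE IH. Qed.
End RestrictOne.

Lemma restrict_serre (Z : 'I_n -> T)
    (hZ : forall i f, f \in serre_dual -> Z i f \in serre_dual) i j x :
  val (serre_elt vs C (fun i => restrict (hZ i)) i j x) =
  serre_elt vs C Z i j (val x).
Proof.
rewrite /serre_elt !endo_sumE (raddf_sum (val : serre_dualmod -> Phi)).
apply: eq_bigr => t _; rewrite !endo_scaleE !endo_mulE.
apply: etrans (dual_valZ _ _) _; congr (_ *: _).
by rewrite restrictXE restrictE restrictXE.
Qed.

Definition dE i := restrict (@wE_dual i).
Definition dF i := restrict (@wF_dual i).
Definition dK i := restrict (@wK_dual i).
Definition dK' i := restrict (@wK'_dual i).

Lemma dual_Uv_rel : Uv_rel vs C dE dF dK dK'.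
Proof.
have lift (X Y : T) : X = Y -> forall x : serre_dualmod, X (val x) = Y (val x).
  by move=> ->.
split=> [i|i|i j|i j|i j|i|i j ij|i j ij|i j ij]; apply: endoP => x; apply: val_inj.
- exact: lift (pre_KK' wpre i) x.
- exact: lift (pre_K'K wpre i) x.
- exact: lift (pre_KC wpre i j) x.
- exact: lift (pre_KE wpre i j) x.
- exact: lift (pre_KF wpre i j) x.
- exact: lift (pre_EF wpre i) x.
- exact: lift (pre_EFC wpre ij) x.
- rewrite -/(serre_elt vs C dE i j) restrict_serre dual_serre //; exact: valP.
- by rewrite -/(serre_elt vs C dF i j) restrict_serre /serre_elt serreF_word.
Qed.

End Restriction.

(** * The homomorphism defined by elements satisfying the Serre relations *)

Section Target.
Variable y : 'I_n -> A.
Hypothesis y_serre : forall i j, i != j -> serre vs C y i j.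

(** The reversed order makes stripping the first letter j of a word act on [eval_word c] as left
    multiplication of c by y_j. *)
Fixpoint word_prod (w : seq 'I_n) : A :=
  if w is j :: w' then word_prod w' * y j else 1.

Definition eval_word (c : A) : Phi := fun w => word_prod w * c.

Lemma wE_eval j c : wE j (eval_word c) = eval_word (y j * c).
Proof. by apply/funext => w; rewrite wE_E /eval_word /= mulrA. Qed.

Lemma wEX_eval j m c : (wE j ^+ m) (eval_word c) = eval_word (y j ^+ m * c).
Proof.
elim: m => [|m IH]; first by rewrite !expr0 mul1r.
by rewrite !exprS endo_mulE IH wE_eval mulrA.
Qed.

Lemma eval_wordD a b c : eval_word (a *: b + c) = a *: eval_word b + eval_word c.
Proof. by apply/funext => w; rewrite fct_linE /eval_word mulrDr scalerAr. Qed.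

Lemma serre_eval i j c :
  serre_elt vs C wE i j (eval_word c) = eval_word (serre_elt vs C y i j * c).
Proof.
apply/funext => w; rewrite /serre_elt endo_sumE fct_sumE /eval_word.
rewrite mulr_suml mulr_sumr; apply: eq_bigr => t _.
rewrite endo_scaleE fct_scaleE !endo_mulE wEX_eval wE_eval wEX_eval.
by rewrite /eval_word !mulrA -scalerAr -scalerAl !mulrA.
Qed.

Lemma eval_dual c : eval_word c \in serre_dual.
Proof.
apply/asboolP => b; elim: b c => [|j b IH] c; last first.
  by change (serre_null b (wE j (eval_word c))); rewrite wE_eval; exact: IH.
move=> i j ij; rewrite serre_eval [X in X * c](y_serre ij) mul0r.
by apply/funext => w; rewrite /eval_word mulr0.
Qed.

Definition eval_elt c : serre_dualmod := SerreDual (eval_dual c).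

Lemma serre_dualmod_neq0 : exists x : serre_dualmod, x != 0.
Proof.
exists (eval_elt 1); apply/eqP => e.
have : val (eval_elt 1) = 0 by rewrite e; exact: raddf0.
move=> /(congr1 (fun f : Phi => f [::])) /eqP.
by rewrite /= /eval_word mulr1 oner_eq0.
Qed.

Local Notation hN := serre_dualmod_neq0.

Lemma dE_eval j c : dE hN j (eval_elt c) = eval_elt (y j * c).
Proof. by apply: val_inj; exact: wE_eval. Qed.

(** The universal property gives an action g of U on [serre_dualmod]. Every x in the positive part
    acts on the elements [eval_elt c] as c |-> a c for some a in the target, since the generators
    do; this a is the image of x. *)
Theorem Uv_plus_lrmorphism (U : algType L) (E F K K' : 'I_n -> U)
    (hU : is_Uv vs C E F K K') (S : A -> Prop)
    (yS : forall i, y i \in gen_alg_pred S) :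
  exists phi : {lrmorphism Uv_plus E -> subalg S},
    forall i, val (phi (Uv_plusE E i)) = y i.
Proof.
have [[g gP] _] := hU.2 _ _ _ _ _ (dual_Uv_rel hN).
(* The multiplier a is read off at c = 1 and the empty word, so no choice is involved. *)
pose ev (x : U) : A := val (g x (eval_elt 1)) [::].
have key x : gen_alg (is_E E) x ->
    ev x \in gen_alg_pred S /\ forall c, g x (eval_elt c) = eval_elt (ev x * c).
  suff H : gen_alg (is_E E) x ->
      exists2 a, a \in gen_alg_pred S & forall c, g x (eval_elt c) = eval_elt (a * c).
    move=> /H [a aS ha]; suff -> : ev x = a by [].
    by rewrite /ev ha /= /eval_word mul1r mulr1.
  elim=> {x} [x [i ->]| |a x z _ [b bS hb] _ [c cS hc]|x z _ [b bS hb] _ [c cS hc]].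
  - by exists (y i) => // c; have [-> _ _ _] := gP i; rewrite dE_eval.
  - by exists 1 => [|c]; rewrite ?rpred1 // rmorph1 mul1r.
  - exists (a *: b + c) => [|e]; first by rewrite rpredD ?rpredZ.
    rewrite linearP endo_addE endo_scaleE hb hc.
    by apply: val_inj; rewrite mulrDl -scalerAl /= eval_wordD.
  - exists (b * c) => [|e]; first by rewrite rpredM.
    by rewrite rmorphM endo_mulE hc hb mulrA.
have genP (x : Uv_plus E) : gen_alg (is_E E) (val x).
  by have /asboolP := valP x.
pose phi (x : Uv_plus E) : subalg S := Subalg (proj1 (key _ (genP x))).
have phi_lin : linear phi.
  move=> a x z; apply: val_inj; rewrite linearP /= /ev.
  by rewrite !linearP.
have phi_mul : monoid_morphism phi.
  split=> [|x z]; apply: val_inj; rewrite /= /ev.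
    by rewrite rmorph1 /= /eval_word mulr1.
  rewrite rmorphM endo_mulE (proj2 (key _ (genP z))).
  by rewrite (proj2 (key _ (genP x))) /= /eval_word !mul1r !mulr1. 
pose phiL := GRing.isLinear.Build L (Uv_plus E) (subalg S) *:%R phi phi_lin.
pose phiM := GRing.isMonoidMorphism.Build (Uv_plus E) (subalg S) phi phi_mul.
pose Phi' : {lrmorphism Uv_plus E -> subalg S} :=
  HB.pack phi phiL phiM.
exists Phi' => i; rewrite /= /ev /=.
have [-> _ _ _] := gP i.
by rewrite dE_eval /= /eval_word mul1r mulr1.
Qed.

End Target.
End WordFunctions.

(** * Extensions of simple representations *)

(** X^N - X, with N = q^m, splits over the closure and has derivative -1, hence N distinct roots. *)
Lemma Fq_enum (k : finFieldType) (m : nat) : (0 < m)%N ->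
  exists h : 'I_(#|k| ^ m)%N -> Fq k m, bijective h.
Proof.
move=> m0; set N := (#|k| ^ m)%N; pose p : {poly kbar k} := 'X^N - 'X.
have q1 : (1 < #|k|)%N by exact: card_finNzRing_gt1.
have N1 : (1 < N)%N by rewrite -(exp1n m) ltn_exp2r.
have sp : size p = N.+1.
  by rewrite size_polyDl size_polyXn // size_polyN size_polyX.
have [rs prs] := closed_field_poly_normal p.
have lp : lead_coef p = 1.
  by rewrite lead_coefDl ?lead_coefXn // size_polyN size_polyX size_polyXn.
rewrite lp scale1r in prs.
have N0 : N%:R = 0 :> kbar k.
  have [pr pr_p chp] := finPcharP k.
  have chK : pr \in [pchar kbar k] by rewrite (fmorph_pchar (kbar_inj k)).
  apply/eqP; rewrite -(dvdn_pcharf chK) /N.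
  rewrite dvdn_exp //; move: q1; rewrite (card_pprimeChar chp).
  by case: (logn _ _) => [|a] // _; rewrite expnS dvdn_mulr.
have urs : uniq rs.
  rewrite -separable_prod_XsubC -prs separable_poly.unlock derivB derivXn derivX.
  rewrite -mulr_natl -polyC_natr N0 mul0r sub0r -scaleN1r.
  by rewrite coprimepZr ?oppr_eq0 ?oner_eq0 ?coprimep1.
have memrs x : (x \in rs) = (x \in Fq_pred m).
  by rewrite -root_prod_XsubC -prs rootE !hornerE subr_eq0 unfold_in.
have srs : size rs = N.
  by apply: succn_inj; rewrite -sp prs size_prod_XsubC.
(* The default 0 is never taken, because every listed root lies in [Fq_pred m]. *)
pose h (i : 'I_N) : Fq k m := insubd 0 (nth 0 rs i).
have hv i : val (h i) = nth 0 rs i.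
  by rewrite val_insubd -memrs mem_nth ?srs.
have memv (x : Fq k m) : val x \in rs by rewrite memrs; case: x.
have hg (x : Fq k m) : (index (val x) rs < N)%N.
  by rewrite -srs index_mem.
exists h; exists (fun x : Fq k m => Ordinal (hg x)) => [i|x].
  by apply: val_inj; rewrite /= hv index_uniq ?srs.
by apply: val_inj; rewrite hv; exact: nth_index (memv x).
Qed.

Section LinearSections.
Variables (K : fieldType) (V W : vectType K) (f : {linear V -> W}).

Lemma linear_section : (forall w, exists v, f v = w) ->
  exists g : {linear W -> V}, cancel g f.
Proof.
move=> fs; exists ((linfun f)^-1)%VF => w.
rewrite -[LHS](lfunE f) limg_lfunVK //.
by have [v <-] := fs w; rewrite -lfunE memv_img ?memvf.
Qed.

Lemma linear_retraction : injective f ->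
  exists g : {linear W -> V}, cancel f g.
Proof.
move=> fi; exists ((linfun f)^-1)%VF => v.
have /lker0_lfunK/(_ v) : lker (linfun f) == 0%VS.
  by apply/lker0P => x y; rewrite !lfunE => /fi.
by rewrite lfunE.
Qed.

End LinearSections.

(** * Extensions of representations whose arrows act by zero *)

Section Extensions.
Variables (k : finFieldType) (n : nat) (Q : valued_quiver n).
Variables (M N : rep k Q).
Hypotheses (M0 : forall t m, rep_map M t m = 0) (N0 : forall t m, rep_map N t m = 0).

(** The image of a lift of m lies in N because arrows vanish on M, and it does not depend on the
    lift because they vanish on N. *)
Lemma ext_map_factor (eta : extension M N) t m :
  exists w, forall e, ext_sur eta _ e = m ->
    rep_map (ext_mid eta) t e = ext_inj eta _ w.
Proof.
have [e0 e0m] := @ext_surP _ _ _ _ _ eta _ m.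
have : ext_sur eta _ (rep_map (ext_mid eta) t e0) = 0 by rewrite hom_mapP M0.
case/ext_exact => w we; exists w => e em.
have : ext_sur eta _ (e - e0) = 0 by rewrite linearB em e0m subrr.
case/ext_exact => w' we'; apply/eqP; rewrite we -subr_eq0 -raddfB -we'.
by rewrite -hom_mapP N0 linear0.
Qed.

(* Since the arrows of M and N act by zero, an arrow of an extension factors
   through M -> N; these maps determine the class in Ext^1. *)
Definition ext_class (eta : extension M N) t (m : M (src t)) : N (tgt t) :=
  projT1 (cid (ext_map_factor eta m)).
Arguments ext_class : clear implicits.

Lemma ext_classP eta t e :
  rep_map (ext_mid eta) t e = ext_inj eta _ (ext_class eta t (ext_sur eta _ e)).
Proof. by rewrite /ext_class; case: cid => w /= ->. Qed.

Lemma ext_class_unique eta t e w :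
  rep_map (ext_mid eta) t e = ext_inj eta _ w ->
  ext_class eta t (ext_sur eta _ e) = w.
Proof. by rewrite ext_classP => /ext_injP. Qed.

Lemma ext_classD eta t m m' :
  ext_class eta t (m + m') = ext_class eta t m + ext_class eta t m'.
Proof.
have [e <-] := @ext_surP _ _ _ _ _ eta _ m.
have [e' <-] := @ext_surP _ _ _ _ _ eta _ m'.
by rewrite -linearD; apply: ext_class_unique; rewrite raddfD !ext_classP linearD.
Qed.

Lemma ext_class0 eta t : ext_class eta t 0 = 0.
Proof. by apply: (addrI (ext_class eta t 0)); rewrite -ext_classD !addr0. Qed.

Lemma ext_classZ eta t c m :
  ext_class eta t (Fq_incl (dvdn_gcdl _ _) c *: m) =
  Fq_incl (dvdn_gcdr _ _) c *: ext_class eta t m.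
Proof.
have [e <-] := @ext_surP _ _ _ _ _ eta _ m.
by rewrite -linearZ; apply: ext_class_unique; rewrite rep_mapZ ext_classP linearZ.
Qed.

Section Baer.
Variables (r : nat) (b : 'I_r -> rep_hom N N) (xi : 'I_r -> extension M N)
  (a : 'I_r -> rep_hom M M).

Definition baer_class t (m : M (src t)) : N (tgt t) :=
  \sum_l b l _ (ext_class (xi l) t (a l _ m)).
Arguments baer_class : clear implicits.

(** Forward: apply the compatibility of [Phi] with an arrow to lifts of the a_l(m). Backward: split
    all extensions linearly at each vertex; compatibility of the resulting [Phi] with arrows is then
    exactly the equality of classes. *)
Lemma baer_combP eta :
  baer_comb b xi a eta <-> forall t m, ext_class eta t m = baer_class t m.
Proof.
split=> [[Phi [Plin Pmap Psur Pinj]] t m|h].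
  have lift l : {e | ext_sur (xi l) _ e = a l _ m} by exact/cid/ext_surP.
  have := Pmap t m (fun l => sval (lift l)) (fun l => svalP (lift l)).
  rewrite M0 [X in Phi _ _ X](_ : _ =
     fun l => ext_inj (xi l) _ (ext_class (xi l) t (a l _ m))); last first.
    by apply/functional_extensionality_dep => l; rewrite ext_classP (svalP (lift l)).
  rewrite Pinj ext_classP Psur => [/ext_injP //|l]; exact: svalP (lift l).
have sec x : {s : {linear M x -> ext_mid eta x} | cancel s (ext_sur eta x)}.
  by apply/cid/linear_section => w; exact: ext_surP.
have retr l x : {p : {linear ext_mid (xi l) x -> N x} | cancel (ext_inj (xi l) x) p}.
  exact/cid/linear_retraction/ext_injP.
have secl l x : {s : {linear M x -> ext_mid (xi l) x} | cancel s (ext_sur (xi l) x)}.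
  by apply/cid/linear_section => w; exact: ext_surP.
(* The projection of the middle term of xi_l onto N along the chosen section. *)
pose rho l x e := sval (retr l x) (e - sval (secl l x) (ext_sur (xi l) x e)).
have rhoP l x c e e' : rho l x (c *: e + e') = c *: rho l x e + rho l x e'.
  rewrite /rho; set u := e - _; set u' := e' - _.
  suff -> : c *: e + e' - sval (secl l x) (ext_sur (xi l) x (c *: e + e')) =
      c *: u + u' by rewrite linearP.
  rewrite [ext_sur _ _ _]linearP [sval (secl l x) _]linearP opprD addrACA.
  by rewrite /u scalerBr.
have rho_inj l x w : rho l x (ext_inj (xi l) x w) = w.
  have e0 : ext_sur (xi l) x (ext_inj (xi l) x w) = 0 by apply/ext_exact; exists w.
  by rewrite /rho e0 linear0 subr0; exact: (svalP (retr l x)).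
pose Phi x m e := sval (sec x) m + ext_inj eta x (\sum_l b l x (rho l x (e l))).
exists Phi; split=> [x c m e m' e' _ _|t m e me|x m e _|x w].
- rewrite /Phi linearP scalerDr addrACA; congr (_ + _).
  rewrite -[RHS]linearP; congr (hom_map _ _ _).
  rewrite scaler_sumr -big_split /=.
  by apply: eq_bigr => l _; rewrite rhoP linearP.
- rewrite ext_classP /Phi M0 linear0 add0r; congr (hom_map _ _ _).
  rewrite linearD (svalP (sec _)) [X in _ + X](_ : _ = 0) ?addr0; last first.
    by apply/ext_exact; eexists.
  by rewrite h; apply: eq_bigr => l _; rewrite ext_classP rho_inj me.
- rewrite /Phi linearD (svalP (sec _)) [X in _ + X](_ : _ = 0) ?addr0 //.
  by apply/ext_exact; eexists.
- rewrite /Phi linear0 add0r; congr (hom_map _ _ _).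
  by apply: eq_bigr => l _; rewrite rho_inj.
Qed.

Lemma baer_classD t m m' : baer_class t (m + m') = baer_class t m + baer_class t m'.
Proof.
rewrite /baer_class -big_split; apply: eq_bigr => l _ /=.
by rewrite linearD ext_classD linearD.
Qed.

Lemma baer_classZ t c m :
  baer_class t (Fq_incl (dvdn_gcdl _ _) c *: m) =
  Fq_incl (dvdn_gcdr _ _) c *: baer_class t m.
Proof.
rewrite /baer_class scaler_sumr; apply: eq_bigr => l _.
by rewrite linearZ ext_classZ linearZ.
Qed.

(** The extension built here is split at every vertex; [baer_class] sits in its arrows. Thus every
    choice of coefficients is realized. *)
Definition baer_sp x : vectType (Fq k (Q x)) := (M x * N x)%type.

Definition baer_map_fun t (p : baer_sp (src t)) : baer_sp (tgt t) :=
  (0, baer_class t p.1).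

Lemma baer_map_additive t : zmod_morphism (@baer_map_fun t).
Proof.
move=> p p'; rewrite /baer_map_fun.
have -> : baer_class t (p - p').1 = baer_class t p.1 - baer_class t p'.1.
  apply/eqP; rewrite eq_sym subr_eq -baer_classD /=.
  by rewrite subrK.
by congr (_, _); rewrite subr0.
Qed.

HB.instance Definition _ t :=
  GRing.isZmodMorphism.Build _ _ (@baer_map_fun t) (@baer_map_additive t).

Lemma baer_mapZ t (c : Fq k (gcdn (Q (src t)) (Q (tgt t)))) (p : baer_sp (src t)) :
  baer_map_fun (Fq_incl (dvdn_gcdl _ _) c *: p) =
  Fq_incl (dvdn_gcdr _ _) c *: baer_map_fun p.
Proof.
by rewrite /baer_map_fun /= baer_classZ; congr (_, _); rewrite scaler0.
Qed.

Definition baer_mid : rep k Q :=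
  @Rep k n Q baer_sp (fun t => @baer_map_fun t) baer_mapZ.

Definition baer_inj_fun x (w : N x) : baer_sp x := (0, w).
Lemma baer_inj_linear x : linear (@baer_inj_fun x).
Proof. by move=> c w w'; apply: injective_projections; rewrite /= ?scaler0 ?addr0. Qed.
HB.instance Definition _ x :=
  GRing.isLinear.Build _ _ _ _ (@baer_inj_fun x) (@baer_inj_linear x).

Definition baer_sur_fun x (p : baer_sp x) : M x := p.1.
Lemma baer_sur_linear x : linear (@baer_sur_fun x).
Proof. by []. Qed.
HB.instance Definition _ x :=
  GRing.isLinear.Build _ _ _ _ (@baer_sur_fun x) (@baer_sur_linear x).

Lemma baer_inj_hom t w : baer_inj_fun (rep_map N t w) = baer_map_fun (baer_inj_fun w).
Proof.
rewrite N0 /baer_inj_fun /baer_map_fun /=; congr (_, _).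
by apply: (addrI (baer_class t 0)); rewrite -baer_classD !addr0.
Qed.

Definition baer_inj : rep_hom N baer_mid :=
  @RepHom k n Q N baer_mid (fun x => @baer_inj_fun x) baer_inj_hom.

Lemma baer_sur_hom t p :
  baer_sur_fun (rep_map baer_mid t p) = rep_map M t (baer_sur_fun p).
Proof. by rewrite M0. Qed.

Definition baer_sur : rep_hom baer_mid M :=
  @RepHom k n Q baer_mid M (fun x => @baer_sur_fun x) baer_sur_hom.

Lemma baer_exact x e : baer_sur x e = 0 <-> exists w, baer_inj x w = e.
Proof.
case: e => m w; split=> [/= e|[w' [<-]] //].
by exists w; rewrite /= /baer_inj_fun; congr (_, _).
Qed.

Lemma baer_injP x : injective (baer_inj x). Proof. by move=> w w' []. Qed.
Lemma baer_surP x w : exists e, baer_sur x e = w. Proof. by exists (w, 0). Qed.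

Definition baer_ext : extension M N :=
  Extension baer_injP baer_surP baer_exact.

Lemma baer_ext_comb : baer_comb b xi a baer_ext.
Proof.
apply/baer_combP => t m.
by rewrite -[m]/(ext_sur baer_ext _ (m, 0)); exact: ext_class_unique.
Qed.

End Baer.
End Extensions.

Lemma linear_rV1 (K : fieldType) (b : bool) (f : {linear 'rV[K]_b -> 'rV[K]_b}) :
  exists c : K, forall w, f w = c *: w.
Proof.
case: b f => f; last by exists 0 => w; rewrite [f w]thinmx0 [_ *: _]thinmx0.
exists (f (const_mx 1) 0 0) => w.
have -> : w = w 0 0 *: const_mx 1.
  by apply/rowP => i; rewrite !mxE ord1 mulr1.
rewrite linearZ /=; apply/rowP => i; rewrite !mxE ord1 mulr1.
by rewrite mulrC.
Qed.

(** * Ext spaces between simples, counted from the left and from the right *)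

Section SimpleExt.
Variables (k : finFieldType) (n : nat) (Q : valued_quiver n).

Lemma simple_map0 i t m : rep_map (simple_rep k Q i) t m = 0.
Proof. by []. Qed.

(** [insubd] moves c from the field at i to the field at x. At x = i it returns c, and elsewhere the
    space is zero, so its value is immaterial. *)
Definition simple_scal_fun i (c : Fq k (Q i)) x (w : simple_rep k Q i x) :
    simple_rep k Q i x :=
  insubd (0 : Fq k (Q x)) (val c) *: w.

Lemma simple_scal_linear i c x : linear (@simple_scal_fun i c x).
Proof.
by move=> a u v; rewrite /simple_scal_fun scalerDr !scalerA [_ * a]mulrC.
Qed.
HB.instance Definition _ i c x :=
  GRing.isLinear.Build _ _ _ _ (@simple_scal_fun i c x) (@simple_scal_linear i c x).

Lemma simple_scal_hom i c t w :
  @simple_scal_fun i c _ (rep_map (simple_rep k Q i) t w) =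
  rep_map (simple_rep k Q i) t (simple_scal_fun c w).
Proof. by rewrite !simple_map0 /simple_scal_fun scaler0. Qed.

Definition simple_scal i c : rep_hom (simple_rep k Q i) (simple_rep k Q i) :=
  RepHom (@simple_scal_hom i c).

Lemma simple_scalE i c w : simple_scal c i w = c *: w :> simple_rep k Q i i.
Proof. by rewrite /= /simple_scal_fun valKd. Qed.

Lemma simple_away i x (w : simple_rep k Q i x) : x != i -> w = 0.
Proof.
move=> xi; have : (x == i : nat) = 0%N by rewrite (negPf xi).
move: w; rewrite /simple_rep /=; move: (nat_of_bool _) => m w m0.
by subst m; rewrite thinmx0.
Qed.

(** Together with [simple_scal_inj] this identifies End(S_i) with the field of q^(d_i) elements. *)
Lemma simple_endo i (b : rep_hom (simple_rep k Q i) (simple_rep k Q i)) :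
  exists c, forall x w, b x w = simple_scal c x w.
Proof.
have [c cP] := @linear_rV1 (Fq k (Q i)) (i == i) (b i).
exists c => x; have [->|xi] := eqVneq x i => w; first by rewrite simple_scalE cP.
by rewrite [LHS]simple_away // [RHS]simple_away.
Qed.

Lemma simple_scal_inj i c c' :
  (forall x w, simple_scal c x w = simple_scal c' x w) -> c = c' :> Fq k (Q i).
Proof.
move=> /(_ i (const_mx 1)); rewrite !simple_scalE => e.
have := congr1 (fun w : 'rV[Fq k (Q i)]_(i == i) => w) e.
have : (i == i : nat) = 1%N by rewrite eqxx.
rewrite /=; move: (nat_of_bool _) => m m1; subst m.
by move=> /rowP /(_ 0); rewrite !mxE !mulr1.
Qed.

Section Count.
Variables (i j : 'I_n) (r r' : nat).
Local Notation Sj := (simple_rep k Q j).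
Local Notation Si := (simple_rep k Q i).
Variables (xi : 'I_r -> extension Sj Si) (xi' : 'I_r' -> extension Sj Si).
Hypothesis hl : forall eta,
    (exists b, baer_comb b xi (fun=> rep_id Sj) eta) /\
    (forall b b', baer_comb b xi (fun=> rep_id Sj) eta ->
       baer_comb b' xi (fun=> rep_id Sj) eta ->
       forall l x w, b l x w = b' l x w).
Hypothesis hr : forall eta,
    (exists a, baer_comb (fun=> rep_id Si) xi' a eta) /\
    (forall a a', baer_comb (fun=> rep_id Si) xi' a eta ->
       baer_comb (fun=> rep_id Si) xi' a' eta ->
       forall l x w, a l x w = a' l x w).

Let lcl (be : 'I_r -> Fq k (Q i)) t m :=
  baer_class (@simple_map0 j) (@simple_map0 i) (fun l => simple_scal (be l)) xi
    (fun=> rep_id Sj) (t := t) m.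
Let rcl (al : 'I_r' -> Fq k (Q j)) t m :=
  baer_class (@simple_map0 j) (@simple_map0 i) (fun=> rep_id Si) xi'
    (fun l => simple_scal (al l)) (t := t) m.

Let combP r0 b x a eta :=
  @baer_combP k n Q Sj Si (@simple_map0 j) (@simple_map0 i) r0 b x a eta.

Lemma left_right be : exists al, forall t m, lcl be (t := t) m = rcl al m.
Proof.
have /combP e := baer_ext_comb (@simple_map0 j) (@simple_map0 i)
  (fun l => simple_scal (be l)) xi (fun=> rep_id Sj).
have [a aP] := (hr (baer_ext (@simple_map0 j) (@simple_map0 i)
  (fun l => simple_scal (be l)) xi (fun=> rep_id Sj))).1.
have al l : {c | forall x w, a l x w = simple_scal c x w} by exact/cid/simple_endo.
exists (fun l => sval (al l)) => t m.
rewrite /lcl -e ((combP _ _ _ _).1 aP) /rcl /baer_class.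
by apply: eq_bigr => l _; rewrite (svalP (al l)).
Qed.

Lemma right_left al : exists be, forall t m, lcl be (t := t) m = rcl al m.
Proof.
have /combP e := baer_ext_comb (@simple_map0 j) (@simple_map0 i)
  (fun=> rep_id Si) xi' (fun l => simple_scal (al l)).
have [b bP] := (hl (baer_ext (@simple_map0 j) (@simple_map0 i)
  (fun=> rep_id Si) xi' (fun l => simple_scal (al l)))).1.
have be l : {c | forall x w, b l x w = simple_scal c x w} by exact/cid/simple_endo.
exists (fun l => sval (be l)) => t m.
rewrite /rcl -e ((combP _ _ _ _).1 bP) /lcl /baer_class.
by apply: eq_bigr => l _; rewrite (svalP (be l)).
Qed.

(** If the classes agree, one and the same extension is the combination for both families, and
    uniqueness of coordinates applies. *)
Lemma left_inj be be' :
  (forall t m, lcl be (t := t) m = lcl be' m) -> be =1 be'.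
Proof.
move=> e l; apply: simple_scal_inj => x w.
pose eta := baer_ext (@simple_map0 j) (@simple_map0 i)
  (fun l => simple_scal (be l)) xi (fun=> rep_id Sj).
have h : baer_comb (fun l => simple_scal (be l)) xi (fun=> rep_id Sj) eta.
  exact: baer_ext_comb.
have h' : baer_comb (fun l => simple_scal (be' l)) xi (fun=> rep_id Sj) eta.
  by apply/combP => t m; rewrite ((combP _ _ _ _).1 h); exact: e.
exact: ((hl eta).2 _ _ h h' l x w).
Qed.

Lemma right_inj al al' :
  (forall t m, rcl al (t := t) m = rcl al' m) -> al =1 al'.
Proof.
move=> e l; apply: simple_scal_inj => x w.
pose eta := baer_ext (@simple_map0 j) (@simple_map0 i)
  (fun=> rep_id Si) xi' (fun l => simple_scal (al l)).
have h : baer_comb (fun=> rep_id Si) xi' (fun l => simple_scal (al l)) eta.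
  exact: baer_ext_comb.
have h' : baer_comb (fun=> rep_id Si) xi' (fun l => simple_scal (al' l)) eta.
  by apply/combP => t m; rewrite ((combP _ _ _ _).1 h); exact: e.
exact: ((hr eta).2 _ _ h h' l x w).
Qed.

(** Matching left and right coordinates of equal class gives injections in both directions between
    the two finite sets of coordinate tuples. *)
Lemma ext_count : ((#|k| ^ Q i) ^ r = (#|k| ^ Q j) ^ r')%N.
Proof.
have [g [g' gK g'K]] := Fq_enum k (valuation_gt0 Q i).
have [h [h' hK h'K]] := Fq_enum k (valuation_gt0 Q j).
have cl1 (f : {ffun 'I_r -> 'I_(#|k| ^ Q i)}) :
    {a : {ffun 'I_r' -> 'I_(#|k| ^ Q j)} |
     forall t m, lcl (g \o f) (t := t) m = rcl (h \o a) m}.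
  apply/cid; have [al alP] := left_right (g \o f).
  exists [ffun l => h' (al l)] => t m; rewrite alP /rcl /baer_class.
  by apply: eq_bigr => l _; rewrite /= ffunE h'K.
have cl2 (a : {ffun 'I_r' -> 'I_(#|k| ^ Q j)}) :
    {f : {ffun 'I_r -> 'I_(#|k| ^ Q i)} |
     forall t m, lcl (g \o f) (t := t) m = rcl (h \o a) m}.
  apply/cid; have [be beP] := right_left (h \o a).
  exists [ffun l => g' (be l)] => t m; rewrite -beP /lcl /baer_class.
  by apply: eq_bigr => l _; rewrite /= ffunE g'K.
have i1 : injective (fun f => sval (cl1 f)).
  move=> f f' e; apply/ffunP => l; apply: (can_inj gK).
  have := @left_inj (g \o f) (g \o f'); apply => t m.
  by rewrite (svalP (cl1 f)) e (svalP (cl1 f')).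
have i2 : injective (fun f => sval (cl2 f)).
  move=> f f' e; apply/ffunP => l; apply: (can_inj hK).
  have := @right_inj (h \o f) (h \o f'); apply => t m.
  by rewrite -(svalP (cl2 f)) e (svalP (cl2 f')).
have := leq_card _ i1; have := leq_card _ i2.
rewrite !card_ffun !card_ord => le1 le2.
by apply/eqP; rewrite eqn_leq le1 le2.
Qed.

(** Without an arrow from j to i all classes vanish, so the coordinates 0 and 1 would describe the
    same extension if r were positive. *)
Lemma ext_no_arrow : ~~ adj Q j i -> r = 0%N.
Proof.
move=> nadj; apply/eqP; rewrite -leqn0 leqNgt; apply/negP => r0.
have lcl0 be t m : lcl be (t := t) m = 0.
  have [tj|] := eqVneq (tgt t) i; last exact: simple_away.
  have [sj|sj] := eqVneq (src t) j.
    by case/existsP: nadj; exists t; rewrite sj tj !eqxx.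
  rewrite /lcl /baer_class big1 // => l _.
  by rewrite (simple_away m sj) linear0 ext_class0 linear0.
have e : (fun=> 0 : Fq k (Q i)) =1 (fun=> 1) :> ('I_r -> _).
  by apply: left_inj => t m; rewrite !lcl0.
by have /eqP := e (Ordinal r0); rewrite eq_sym oner_eq0.
Qed.

End Count.

Theorem ext_dims_sym (r r' : 'I_n -> 'I_n -> nat) : ext_dims k Q r r' ->
  forall i j, (Q i * r i j = Q j * r' j i)%N.
Proof.
move=> h i j; have [[xi hl] _] := h i j; have [_ [xi' hr]] := h j i.
have := ext_count hl hr; rewrite -!expnM => /eqP.
by rewrite eqn_exp2l ?card_finNzRing_gt1 // => /eqP.
Qed.

Theorem ext_dims_arrow (r r' : 'I_n -> 'I_n -> nat) : ext_dims k Q r r' ->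
  forall i j, r i j != 0%N -> adj Q j i.
Proof.
move=> h i j; have [[xi hl] _] := h i j.
by apply: contraR => /(ext_no_arrow hl) ->.
Qed.

End SimpleExt.

(** * Serre relations in the quantum torus *)

Section QuantumPlane.
Variables (L : fieldType) (A : algType L).

(** At each stage the two terms containing b cancel: moving b past a^k yields w^(-2k), which the
    scalar x w^(2k) compensates. *)
Lemma qad_planeE (a b s : A) (x w : L) k :
    w != 0 ->
    a * b = w ^- 2 *: (b * a) -> a * s = x^-1 *: (s * a) -> b * s = x *: (s * b) ->
  qad (a + b) x w k s = (\prod_(j < k) (x^-1 - x * w ^+ j.*2)) *: (s * a ^+ k).
Proof.
move=> w0 ab as_ bs; elim: k => [|k IH] /=; first by rewrite big_ord0 scale1r mulr1.
have akb : a ^+ k * b = w ^- k.*2 *: (b * a ^+ k).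
  elim: k {IH} => [|k IH]; first by rewrite invr1 scale1r mul1r mulr1.
  rewrite exprSr -[LHS]mulrA ab -scalerAr [a ^+ k * (b * a)]mulrA IH.
  rewrite -scalerAl scalerA mulrA.
  by rewrite -invfM -exprD doubleS.
rewrite IH big_ord_recr /= -scalerAr -scalerAl scalerA [_ * \prod_(i < k) _]mulrC.
rewrite -!scalerA -!scalerBr; congr (_ *: _).
rewrite mulrDl mulrDr scalerDr -[s * a ^+ k * b]mulrA akb -scalerAr !scalerA.
rewrite mulfV ?expf_neq0 // scale1r scalerDr scalerA.
rewrite [a * (s * _)]mulrA as_ [b * (s * _)]mulrA bs -!scalerAl -!mulrA -exprSr -exprS.
by rewrite opprD addrACA subrr addr0 scalerBl.
Qed.

(** For x = w^(1-N) the factor j = N - 1 of the product in [qad_planeE] is zero, as x w^(2(N-1)) = 1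
    / x. *)
Lemma qad_plane0 (a b s : A) (w : L) N : (0 < N)%N -> w != 0 ->
    a * b = w ^- 2 *: (b * a) ->
    a * s = (w * w ^- N)^-1 *: (s * a) -> b * s = (w * w ^- N) *: (s * b) ->
  qad (a + b) (w * w ^- N) w N s = 0.
Proof.
move=> N0 w0 ab as_ bs; rewrite (qad_planeE _ w0 ab as_ bs).
case: N N0 {as_ bs} => // N _; rewrite big_ord_recr /=.
rewrite [X in _ * X](_ : _ = 0) ?mulr0 ?scale0r //.
rewrite -addnn exprD exprS; have := expf_neq0 N w0.
by move: (w ^+ N) => u u0; field; rewrite u0 w0 oner_eq0.
Qed.

Lemma qad_eigen_ends (Z s : A) (w : L) N : (0 < N)%N -> w != 0 ->
    Z * s = (w * w ^- N) *: (s * Z) \/ Z * s = (w * w ^- N)^-1 *: (s * Z) ->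
  qad Z (w * w ^- N) w N s = 0.
Proof.
move=> N0 w0 [|] e; first by apply: (@qad_eigen0 _ _ _ _ _ _ 0%N); rewrite ?mulr1.
apply: (@qad_eigen0 _ _ _ _ _ _ N.-1); rewrite ?prednK //.
rewrite e; congr (_ *: _); case: N N0 {e} => // N _ /=.
rewrite -addnn exprD exprS; have := expf_neq0 N w0.
by move: (w ^+ N) => u u0; field; rewrite ?u0 ?w0 ?oner_eq0.
Qed.

(* Applied to y_i = a + b and y_j = s + s'.  According to the direction of the
   arrows between i and j, the four monomials are ordered a, s, b, s' or
   s, a, s', b, and the one between a and b is the one that needs a chain. *)
Lemma qad_two_terms (a b s s' : A) (w : L) N : (0 < N)%N -> w != 0 ->
    a * b = w ^- 2 *: (b * a) ->
    b * s = (w * w ^- N) *: (s * b) -> a * s' = (w * w ^- N)^-1 *: (s' * a) ->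
    (a * s = (w * w ^- N) *: (s * a) /\ b * s' = (w * w ^- N) *: (s' * b)) \/
    (a * s = (w * w ^- N)^-1 *: (s * a) /\ b * s' = (w * w ^- N)^-1 *: (s' * b)) ->
  qad (a + b) (w * w ^- N) w N (s + s') = 0.
Proof.
move=> N0 w0 ab bs as' [[as_ bs']|[as_ bs']]; rewrite linearD /=.
  rewrite (qad_plane0 N0 w0 ab as' bs') addr0; apply: qad_eigen_ends => //.
  by left; rewrite mulrDl as_ bs mulrDr scalerDr.
rewrite (qad_plane0 N0 w0 ab as_ bs) add0r; apply: qad_eigen_ends => //.
by right; rewrite mulrDl as' bs' mulrDr scalerDr.
Qed.

End QuantumPlane.

(** * Monomials of the quantum torus and their commutation *)

Section TorusMonomials.
Variables (q m : nat) (q0 : (0 < q)%N) (Lam : 'M[rat]_m).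
Variables (F : unitAlgType (Qroot q)) (X : 'rV[int]_m -> F).
Hypothesis hX : is_torus_frac Lam X.

Lemma qroot4 : qroot q ^+ 4 = q%:R.
Proof.
apply: (fmorph_inj (Qroot_inj q)); rewrite rmorphXn /= qrootE rmorph_nat.
by rewrite rootCK.
Qed.

Lemma qroot_neq0 : qroot q != 0.
Proof.
have : qroot q ^+ 4 != 0.
  by rewrite qroot4 -(fmorph_eq0 (Qroot_inj q)) rmorph_nat pnatr_eq0 -lt0n.
by apply: contra => /eqP ->; rewrite expr0n.
Qed.

Lemma qpow_neq0 s : qpow q s != 0.
Proof. by rewrite expfz_neq0 ?qroot_neq0. Qed.

Lemma torus_neq0 e : X e != 0.
Proof.
apply/eqP => Xe.
have := torus_free hX (s := [:: e]) (c := fun=> 1) isT.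
rewrite big_seq1 Xe scaler0 => /(_ erefl e); rewrite inE eqxx => /(_ isT)/eqP.
by rewrite oner_eq0.
Qed.

Lemma torus_is_unit e : X e \is a GRing.unit.
Proof. exact/(torus_unit hX)/torus_neq0. Qed.

(** Scalars are forgotten because commutation factors depend on the exponents only. *)
Definition monomial (z : F) (e : 'rV[int]_m) : Prop := exists a, z = a *: X e.

Lemma monomialM z z' e e' :
  monomial z e -> monomial z' e' -> monomial (z * z') (e + e').
Proof.
move=> [a ->] [b ->]; exists (a * (b * qpow q (2%:R^-1 * lform Lam e e'))).
by rewrite -scalerAl -scalerAr (torusM hX) !scalerA mulrA.
Qed.

Lemma monomial1 : monomial 1 0.
Proof. by exists 1; rewrite (torus1 hX) scale1r. Qed.

Lemma monomial_inv e : monomial (X e)^-1 (- e).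
Proof.
set b := qpow q (2%:R^-1 * lform Lam e (- e)).
exists b^-1; apply: (mulrI (torus_is_unit e)).
rewrite divrr ?torus_is_unit // -scalerAr (torusM hX) subrr (torus1 hX) scalerA.
by rewrite mulVf ?scale1r ?qpow_neq0.
Qed.

Lemma monomialXz e (c : int) : monomial (X e ^ c) (c *: e).
Proof.
have nat_case z f (k : nat) : monomial z f -> monomial (z ^+ k) (k%:Z *: f).
  move=> h; elim: k => [|k IH]; first by rewrite scale0r; exact: monomial1.
  rewrite exprS intS scalerDl scale1r; exact: monomialM.
case: c => k; first by apply: nat_case; exists 1; rewrite scale1r.
rewrite NegzE -exprnN -exprVn scaleNr -scalerN; apply: nat_case.
exact: monomial_inv.
Qed.

Lemma monomial_prod (c : 'I_m -> int) :
  monomial (\prod_i X (delta_mx 0 i) ^ c i) (\row_i c i).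
Proof.
rewrite [\row_i _]row_sum_delta.
elim/big_rec2: _ => [|i z e _ h]; first exact: monomial1.
by apply: monomialM => //; rewrite mxE; exact: monomialXz.
Qed.

Lemma monomialZ a z e : monomial z e -> monomial (a *: z) e.
Proof. by move=> [b ->]; exists (a * b); rewrite scalerA. Qed.

(** X^e X^e' and X^e' X^e differ by q^(g/2) = v^g, with v = [qroot q ^+ 2]. *)
Lemma monomial_comm z z' e e' (g : int) :
    monomial z e -> monomial z' e' ->
    lform Lam e e' = 2%:R^-1 * g%:~R -> lform Lam e' e = - (2%:R^-1 * g%:~R) ->
  z * z' = (qroot q ^+ 2) ^ g *: (z' * z).
Proof.
move=> [a ->] [b ->] l l'.
have qE (h : int) : qpow q (2%:R^-1 * (2%:R^-1 * h%:~R)) = qroot q ^ h.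
  rewrite /qpow; congr (_ ^ _); rewrite !mulrA.
  by rewrite (_ : 4%:R * _^-1 * _^-1 = 1) // mul1r numq_int.
rewrite -!scalerAl -!scalerAr !(torusM hX) l l' -mulrN -rmorphN !qE.
rewrite [e' + e]addrC !scalerA; congr (_ *: _).
rewrite expr2 expfzMl -invr_expz.
have c0 := expfz_neq0 g qroot_neq0; set c := _ ^ g in c0 *.
by rewrite [RHS]mulrC -!mulrA mulKf // mulrA [RHS]mulrC [b * a]mulrC.
Qed.

End TorusMonomials.

(** * Acyclicity and the form of the compatible pair *)

Section CompatiblePairForm.
Variables (n : nat) (Q : valued_quiver n) (r r' : 'I_n -> 'I_n -> nat).
Hypotheses (acyc : acyclic Q)
  (rsym : forall i j, (Q i * r i j = Q j * r' j i)%N)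
  (rarr : forall i j, r i j != 0%N -> adj Q j i).

Lemma r'_arrow i j : r' i j != 0%N -> adj Q i j.
Proof.
move=> h; apply: rarr; apply: contra h => /eqP h.
have := rsym j i; rewrite h muln0 => /esym/eqP; rewrite muln_eq0.
by rewrite eqn0Ngt valuation_gt0.
Qed.

Lemma acyclic_path i p : path (adj Q) i p -> i \notin p.
Proof.
move=> pi; apply/negP => ip; case/splitPr: ip pi => p1 p2.
rewrite -cat_rcons cat_path => /andP[pi _].
have := acyc (i := i) (p := rcons p1 i) _ pi.
by rewrite last_rcons eqxx -size_eq0 size_rcons => /(_ isT).
Qed.

Lemma no_loop i : ~~ adj Q i i.
Proof.
apply/negP => h; have := @acyclic_path i [:: i].
by rewrite /= h inE eqxx => /(_ isT).
Qed.

Lemma no_2cycle i j : adj Q i j -> ~~ adj Q j i.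
Proof.
move=> h; apply/negP => h'; have := @acyclic_path i [:: j; i].
by rewrite /= h h' !inE eqxx orbT => /(_ isT).
Qed.

Lemma r_or_r' i j : r i j = 0%N \/ r' i j = 0%N.
Proof.
have [->|/rarr a] := eqVneq (r i j) 0%N; first by left.
right; apply/eqP; apply: contraT => /r'_arrow b.
by have := no_2cycle a; rewrite b.
Qed.

Lemma r_or_rT i j : r i j = 0%N \/ r j i = 0%N.
Proof.
have [->|/rarr a] := eqVneq (r i j) 0%N; first by left.
right; apply/eqP; apply: contraT => /rarr b.
by have := no_2cycle a; rewrite b.
Qed.

Lemma r_diag i : r i i = 0%N.
Proof. by apply/eqP; apply: contraT => /rarr; rewrite (negPf (no_loop i)). Qed.

Let Rm : 'M[rat]_n := \matrix_(i, j) (r i j)%:R.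
Let Rm' : 'M[rat]_n := \matrix_(i, j) (r' i j)%:R.

(** Suppose u = u R with u nonzero. Among the j with u_j nonzero take one reaching the fewest
    vertices; the equation at j gives an arrow from j to some i with u_i nonzero, and by acyclicity
    i reaches strictly fewer. *)
Lemma unipotent_unit : 1%:M - Rm \in unitmx.
Proof.
rewrite -row_free_unit -kermx_eq0; apply/rowV0P => u /sub_kermxP uR.
have uE j : u 0 j = \sum_i u 0 i * (r i j)%:R.
  have := congr1 (fun w : 'rV_n => w 0 j) uR.
  rewrite mulmxBr mulmx1 !mxE => /eqP; rewrite subr_eq0 => /eqP ->.
  by apply: eq_bigr => i _; rewrite mxE.
apply/rowP => j0; rewrite [RHS]mxE; apply/eqP; apply: contraT => uj0.
pose sz j := #|[pred x | connect (adj Q) j x]|.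
case: (@arg_minnP _ j0 (fun j => u 0 j != 0) sz uj0) => j uj jmin.
have [i ui aji] : exists2 i, u 0 i != 0 & adj Q j i.
  have : [exists i, (u 0 i != 0) && (r i j != 0%N)].
    apply: contraNT uj => /existsPn h; rewrite uE big1 // => i _.
    have := h i; rewrite negb_and !negbK => /orP[] /eqP ->.
      by rewrite mul0r.
    by rewrite mulr0.
  by case/existsP => i /andP[ui /rarr]; exists i.
have := jmin i ui; rewrite leqNgt => /negP; case.
apply/proper_card/properP; split.
  by apply/subsetP => x; rewrite !inE; apply: connect_trans; exact: connect1.
exists j; rewrite !inE ?connect0 //; apply/negP => /connectP[p ip jl].
have := @acyclic_path j (i :: p); rewrite /= aji ip jl => /(_ isT).
by rewrite mem_last.
Qed.

Lemma Dmx_unit : Dmx Q \in unitmx.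
Proof.
rewrite unitmxE det_diag unitfE; apply/prodf_neq0 => i _.
by rewrite mxE pnatr_eq0 -lt0n valuation_gt0.
Qed.

Lemma EmxE i j : Emx Q r i j = ((i == j)%:R - (r j i)%:R) * (Q j)%:R.
Proof. by rewrite /Emx mul_mx_diag !mxE. Qed.

Lemma DEmx : invmx (Dmx Q) *m Emx Q r = 1%:M - Rm'.
Proof.
apply: (canLR (mulKmx Dmx_unit)); apply/matrixP => i j.
rewrite EmxE mul_diag_mx !mxE mulrBl mulrBr -!natrM mulnC.
rewrite [(r j i * Q j)%N]mulnC rsym; congr (_ - _).
by case: eqVneq => [->|]; rewrite ?muln1 ?mul1n ?muln0 ?mul0n.
Qed.

Lemma DEmxT : invmx (Dmx Q) *m (Emx Q r)^T = 1%:M - Rm.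
Proof.
apply: (canLR (mulKmx Dmx_unit)); apply/matrixP => i j.
by rewrite mxE EmxE mul_diag_mx !mxE eq_sym mulrC.
Qed.

Lemma ThetaE : Thetamx Q r = block_mx (Rm' - 1%:M) (Rm - 1%:M) 1%:M 0.
Proof. by rewrite /Thetamx DEmx DEmxT !opprB. Qed.

(** For a row (u1, u2) in the kernel, the second block gives u1 (R - 1) = 0, so u1 = 0, and then the
    first block gives u2 = 0. *)
Lemma Theta_unit : Thetamx Q r \in unitmx.
Proof.
rewrite -row_free_unit -kermx_eq0; apply/rowV0P => u /sub_kermxP.
rewrite -[u]hsubmxK ThetaE mul_row_block mulmx0 addr0 mulmx1.
rewrite -(row_mx0 _ _ n n).
move=> /eq_row_mx [e1 e2].
have u1 : lsubmx u = 0.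
  rewrite -[LHS](mulmxK unipotent_unit) -[1%:M - Rm]opprB mulmxN e2.
  by rewrite oppr0 mul0mx.
by move: e1; rewrite u1 mul0mx add0r => ->; rewrite row_mx0.
Qed.

(** The rows of the transpose of Theta are the columns of Theta, on which the two inverses in
    [Lambda2] cancel. *)
Lemma Lambda2_Theta a b :
  (row a (Thetamx Q r)^T *m Lambda2 Q r *m (row b (Thetamx Q r)^T)^T) 0 0 =
  2%:R^-1 * Gammamx Q r a b.
Proof.
rewrite /Lambda2 !rowE trmx_mul trmxK -scalemxAr -scalemxAl mxE.
congr (_ * _); rewrite -!mulmxA.
rewrite [(_)^T *m ((invmx _)^T *m _)]mulmxA -trmx_mul mulVmx ?Theta_unit //.
rewrite trmx1 mul1mx [invmx _ *m (_ *m _)]mulmxA mulVmx ?Theta_unit // mul1mx.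
by rewrite -rowE trmx_delta -colE !mxE.
Qed.

End CompatiblePairForm.

Section CartanMatrix.
Variables (n : nat) (Q : valued_quiver n) (r r' : 'I_n -> 'I_n -> nat).
Local Notation C := (cartan r r').

Lemma posp_sub (a b : nat) : a = 0%N \/ b = 0%N -> posp (a%:Z - b%:Z) = a%:Z.
Proof. by rewrite /posp; case=> ->; lia. Qed.

Lemma cartan_diag i : C i i = 2.
Proof. by rewrite mxE eqxx. Qed.

Lemma cartan_off i j : i != j -> C i j <= 0.
Proof. by rewrite mxE => /negPf ->; lia. Qed.

(* The Euler form <S_i, S_j>. *)
Definition euler_form i j : int := (i == j)%:Z * (Q i)%:Z - (r j i * Q j)%:Z.

Local Notation euler := euler_form.

Hypotheses (acyc : acyclic Q)
  (rsym : forall i j, (Q i * r i j = Q j * r' j i)%N)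
  (rarr : forall i j, r i j != 0%N -> adj Q j i).

Lemma cartan_euler i j : i != j -> (Q i)%:Z * C i j = euler i j + euler j i.
Proof.
rewrite mxE /euler_form [j == i]eq_sym => /negPf ->.
by have := rsym i j; have := rsym j i; lia.
Qed.

Lemma euler0 i j : i != j -> euler i j = 0 \/ euler j i = 0.
Proof.
rewrite /euler_form [j == i]eq_sym => /negPf ->.
by case: (r_or_rT acyc rarr i j) => ->; [right|left]; lia.
Qed.

End CartanMatrix.

(** * The Serre relations for the once-mutated cluster variables *)

Section ClusterVariables.
Variables (q n : nat) (q1 : (1 < q)%N) (Q : valued_quiver n).
Variables (r r' : 'I_n -> 'I_n -> nat).
Hypotheses (acyc : acyclic Q)
  (rsym : forall i j, (Q i * r i j = Q j * r' j i)%N)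
  (rarr : forall i j, r i j != 0%N -> adj Q j i).
Variables (F : unitAlgType (Qroot q)) (X : 'rV[int]_(n + n) -> F).
Hypothesis hX : is_torus_frac (Lambda2 Q r) X.

Let s0 := init_seed Q r r' X.
Let q0 : (0 < q)%N := ltnW q1.
Let v := qroot q ^+ 2.
Let vs i := v ^+ Q i.
Local Notation C := (cartan r r').
Local Notation euler := (euler_form Q r).

Lemma v_neq0 : v != 0.
Proof. by rewrite expf_neq0 ?qroot_neq0. Qed.

Lemma vs_neq0 i : vs i != 0.
Proof. by rewrite expf_neq0 ?v_neq0. Qed.

(** v_i^(2a) = q^(d_i a), a nontrivial power of q > 1. *)
Lemma vs_generic i a : (0 < a)%N -> vs i ^+ a.*2 != 1.
Proof.
move=> a0; rewrite /vs /v -!exprM -(fmorph_eq1 (Qroot_inj q)).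
have -> : (2 * (Q i * a.*2) = 4 * (Q i * a))%N by lia.
rewrite exprM rmorphXn /= qroot4 rmorph_nat -natrX pnatr_eq1.
by rewrite -(expn0 q) eqn_exp2l // -lt0n muln_gt0 valuation_gt0 a0.
Qed.

Lemma vsC i j : i != j -> vs i ^ C i j = v ^ (euler i j + euler j i).
Proof. by move=> ij; rewrite -(cartan_euler rsym) // /vs exprnP exprz_exp. Qed.

Lemma cartan_vsym i j : vs i ^ C i j = vs j ^ C j i.
Proof.
have [->|ij] := eqVneq i j; first by [].
by rewrite vsC // addrC -vsC // eq_sym.
Qed.

Definition exp_plus i : 'rV[int]_(n + n) :=
  \row_l (posp (Btilde r r' l i) - (l == lshift n i)%:Z).
Definition exp_minus i : 'rV[int]_(n + n) :=
  \row_l (posp (- Btilde r r' l i) - (l == lshift n i)%:Z).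

(** At most one of r_xi and r'_xi is nonzero, so the positive part of r'_xi - r_xi is r'_xi: this
    yields the block R' - 1 of Theta. *)
Lemma exp_plusE i : map_mx intr (exp_plus i) = row (lshift n i) (Thetamx Q r)^T.
Proof.
apply/rowP => l; rewrite (ThetaE rsym) [LHS]mxE [in LHS]mxE 2![RHS]mxE /Btilde.
rewrite -[l]fintype.splitK.
case: (fintype.split l) => x /=; rewrite ?col_mxEu ?col_mxEd.
  rewrite row_mxEl !mxE posp_sub ?eq_lshift //; last first.
    by case: (r_or_r' acyc rsym rarr x i); auto.
  by rewrite rmorphB /= -!pmulrn.
rewrite row_mxEl !mxE eq_rlshift subr0.
by case: eqP.
Qed.

Lemma exp_minusE i : map_mx intr (exp_minus i) = row (rshift n i) (Thetamx Q r)^T.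
Proof.
apply/rowP => l; rewrite (ThetaE rsym) [LHS]mxE [in LHS]mxE 2![RHS]mxE /Btilde.
rewrite -[l]fintype.splitK.
case: (fintype.split l) => x /=; rewrite ?col_mxEu ?col_mxEd.
  rewrite row_mxEr !mxE opprB posp_sub ?eq_lshift //; last first.
    by case: (r_or_r' acyc rsym rarr x i); auto.
  by rewrite rmorphB /= -!pmulrn.
rewrite row_mxEr !mxE eq_rlshift subr0 /posp.
by case: eqP.
Qed.

Let EmxI i j : Emx Q r i j = (euler i j)%:~R.
Proof.
rewrite EmxE /euler; case: eqVneq => [->|_]; rewrite rmorphB /= ?mul1r ?mul0r -!pmulrn.
  by rewrite mulrBl mul1r natrM.
by rewrite mulrBl mul0r natrM.
Qed.

(** This and the next three lemmas read off the four blocks of Gamma, halved. *)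
Lemma lform_pp i j : lform (Lambda2 Q r) (exp_plus i) (exp_plus j) =
  2%:R^-1 * (euler j i - euler i j)%:~R.
Proof.
rewrite /lform !exp_plusE (Lambda2_Theta acyc rsym rarr); congr (_ * _).
rewrite /Gammamx block_mxEul; move: (Emx Q r) EmxI => e eE.
by rewrite !mxE !eE; move: (euler i j) (euler j i) => a b; rewrite rmorphB.
Qed.

Lemma lform_pm i j : lform (Lambda2 Q r) (exp_plus i) (exp_minus j) =
  2%:R^-1 * (- (euler i j + euler j i))%:~R.
Proof.
rewrite /lform !exp_plusE !exp_minusE (Lambda2_Theta acyc rsym rarr); congr (_ * _).
rewrite /Gammamx block_mxEur; move: (Emx Q r) EmxI => e eE.
rewrite !mxE !eE; move: (euler i j) (euler j i) => a b.
by rewrite rmorphN rmorphD opprD addrC.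
Qed.

Lemma lform_mp i j : lform (Lambda2 Q r) (exp_minus i) (exp_plus j) =
  2%:R^-1 * (euler i j + euler j i)%:~R.
Proof.
rewrite /lform !exp_plusE !exp_minusE (Lambda2_Theta acyc rsym rarr); congr (_ * _).
rewrite /Gammamx block_mxEdl; move: (Emx Q r) EmxI => e eE.
by rewrite !mxE !eE; move: (euler i j) (euler j i) => a b; rewrite rmorphD addrC.
Qed.

Lemma lform_mm i j : lform (Lambda2 Q r) (exp_minus i) (exp_minus j) =
  2%:R^-1 * (euler j i - euler i j)%:~R.
Proof.
rewrite /lform !exp_minusE (Lambda2_Theta acyc rsym rarr); congr (_ * _).
rewrite /Gammamx block_mxEdr; move: (Emx Q r) EmxI => e eE.
by rewrite !mxE !eE; move: (euler i j) (euler j i) => a b; rewrite rmorphB.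
Qed.

Lemma seed_monomial (c : 'I_(n + n) -> int) : monomial X (seed_mono s0 c) (\row_l c l).
Proof. by apply: monomialZ; exact: (monomial_prod q0 hX). Qed.

Lemma mut_var_monomials i : exists a b,
  [/\ mut_var s0 i = a + b, monomial X a (exp_plus i) & monomial X b (exp_minus i)].
Proof.
exists (seed_mono s0 (fun l => posp (Btilde r r' l i) - (l == lshift n i)%:Z)).
exists (seed_mono s0 (fun l => posp (- Btilde r r' l i) - (l == lshift n i)%:Z)).
split; [by rewrite /mut_var /= eqxx|exact: seed_monomial..].
Qed.

Lemma mut_var_serre (c : 'I_n -> Qroot q) i j : i != j ->
  serre vs C (fun i => c i *: mut_var s0 i) i j.
Proof.
move=> ij; pose y i := c i *: mut_var s0 i.
have -> : serre vs C y i j = (qad (y i) (vs i * vs i ^- `|(1 - C i j)%R|) (vs i)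
    `|(1 - C i j)%R| (y j) = 0).
  by rewrite -(@serre_sumE _ _ _ vs C y i j) ?vs_neq0 //; exact: vs_generic.
rewrite /y {y}.
have [a [b [-> ha hb]]] := mut_var_monomials i.
have [s [s' [-> hs hs']]] := mut_var_monomials j.
have := serre_exp vs_neq0 (@cartan_off n r r') ij.
have : (0 < `|(1 - C i j)%R|)%N by have := cartan_off r r' ij; lia.
move: `|_|%N => N N0; rewrite vsC // => /esym xE.
(* The scalars c_i and c_j are absorbed into the monomials. *)
rewrite !scalerDr.
move: {ha hb hs hs'} (monomialZ (c i) ha) (monomialZ (c i) hb)
  (monomialZ (c j) hs) (monomialZ (c j) hs').
move: (c i *: a) (c i *: b) (c j *: s) (c j *: s') => {}a {}b {}s {}s' ha hb hs hs'.
have comm := monomial_comm q0 hX.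
apply: qad_two_terms => //; first exact: vs_neq0.
- rewrite (comm _ _ _ _ _ ha hb (lform_pm i i)) ?lform_mp ?rmorphN ?mulrN ?opprK //.
  congr (_ *: _); rewrite -/v /vs -exprM -invr_expz exprnP; congr (_ ^ _)^-1.
  by rewrite /euler_form eqxx (r_diag acyc rarr); lia.
- rewrite (comm _ _ _ _ _ hb hs (lform_mp i j)) ?xE // lform_pm.
  by rewrite [euler j i + _]addrC rmorphN mulrN.
- rewrite (comm _ _ _ _ _ ha hs' (lform_pm i j)) ?xE ?invr_expz // lform_mp.
  by rewrite [euler j i + _]addrC rmorphN mulrN opprK.
have sk (g h : int) : 2%:R^-1 * (g - h)%:~R = - (2%:R^-1 * (h - g)%:~R) :> rat.
  by rewrite -mulrN -rmorphN opprB.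
have as_ : a * s = v ^ (euler j i - euler i j) *: (s * a).
  by apply: (comm _ _ _ _ _ ha hs (lform_pp i j)); rewrite lform_pp; exact: sk.
have bs' : b * s' = v ^ (euler j i - euler i j) *: (s' * b).
  by apply: (comm _ _ _ _ _ hb hs' (lform_mm i j)); rewrite lform_mm; exact: sk.
rewrite xE invr_expz.
(* If <S_i, S_j> = 0, the factor v^(<S_j, S_i> - <S_i, S_j>) equals v_i^(c_ij); if <S_j, S_i> = 0,
   it is the inverse. These are the two alternatives of [qad_two_terms]. *)
case: (euler0 acyc rarr ij) as_ bs' => e0;
  rewrite e0 ?subr0 ?sub0r ?addr0 ?add0r => as_ bs'.
  by left.
by right.
Qed.

Lemma mut_var_cluster i : qcluster_var s0 (mut_var s0 i).
Proof. by exists [:: i], i. Qed.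

End ClusterVariables.

Theorem corollary5p7 (k : finFieldType) (n : nat) (Q : valued_quiver n)
    (hQ : acyclic Q)
    (r r' : 'I_n -> 'I_n -> nat) (hr : ext_dims k Q r r')
    (q := #|k|) (v := qroot q ^+ 2)
    (U : algType (Qroot q)) (E F K K' : 'I_n -> U)
    (hU : is_Uv (fun i => v ^+ Q i) (cartan r r') E F K K')
    (Frac : unitAlgType (Qroot q)) (X : 'rV[int]_(n + n) -> Frac)
    (hX : is_torus_frac (Lambda2 Q r) X)
    (s0 := init_seed Q r r' X) :
  exists phi : {lrmorphism Uv_plus E -> qcluster_alg s0},
    forall i : 'I_n,
      val (phi (Uv_plusE E i))
      = (qroot q ^+ Q i * ((q ^ Q i)%N%:R - 1)^-1) *: mut_var s0 i.
Proof.
have q1 : (1 < q)%N by exact: card_finNzRing_gt1.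
have rsym := ext_dims_sym hr; have rarr := ext_dims_arrow hr.
pose y i := (qroot q ^+ Q i * ((q ^ Q i)%N%:R - 1)^-1) *: mut_var s0 i.
have yS i : y i \in gen_alg_pred (fun z => frozen s0 z \/ qcluster_var s0 z).
  by apply: rpredZ; apply/asboolP/gen_alg_gen; right; exact: mut_var_cluster.
(* [mut_var_serre] allows arbitrary scalar multiples, among them v_i^(1/2) / (q_i - 1). *)
have yserre i j : i != j -> serre (fun i => v ^+ Q i) (cartan r r') y i j.
  move=> ij; exact: (mut_var_serre q1 hQ rsym rarr hX _ ij).
exact: (Uv_plus_lrmorphism (vs_neq0 q1 Q) (vs_generic q1 Q) (cartan_diag r r')
  (cartan_off r r') (cartan_vsym q rsym) yserre hU yS).
Qed.
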